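(* Let $\sigma$ be a stability condition on the heart $\mathrm{mod}\,A_3^{\otimes 5}$ of $D^b_G(\mathrm{Coh}\,X)$ with central charge of quintic periods: either $Z_x$ with $x$ near the large complex structure limit $0$, or $Z_x$ with $x$ near the Gepner point $\infty$, or $Z'_x$ with $x$ near $0$, the stable objects of $\sigma$ being the simple representations. Then for each stable object $S$ of $D^b(\mathrm{Coh}\,X)$, the motivic Donaldson–Thomas invariants of $S$ give the quasimodular form $G_2(\frac\tau2)-G_2(\tau)$; that is, $S$ is a spherical object and its motivic Donaldson–Thomas generating series $\mathbf E(q^{1/2},z)$ satisfies, with $q=e^{2\pi i\tau}$ and $z=e^{2\pi i\tau'}$, $$\left.\frac{\partial^2}{\partial\tau'^2}\log_z\mathbf E(q^{1/2},z)\right|_{z=1}=G_2\!\left(\frac\tau2\right)-G_2(\tau).$$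
   Context: **Categories.** $X=\{x_1^5+\dots+x_5^5=0\}\subset\mathbb P^4_{\mathbb C}$, with $G\cong\mathbb Z_5^5/\mathbb Z_5$ acting on coordinates by fifth roots of unity. $A_3^{\otimes5}$ is the quiver with vertices $s=\{s_1,\dots,s_5\}$, $0\le s_i\le3$, an arrow $s\to s'$ whenever $s'$ is obtained from $s$ by raising one $s_i$ by $1$, and all squares commuting. It is known that $D^b_G(\mathrm{Coh}\,X)\cong D^b(\mathrm{mod}\,A_3^{\otimes5})$, and that forgetting the equivariance takes the simple representation $s$ to $\tau_0^{-\sum s_i}(\mathcal O_X)$, where $\tau_0$ is the autoequivalence $\tau_0(E)=\mathcal O(1)\otimes T_{\mathcal O_X}(E)$ of $D^b(\mathrm{Coh}\,X)$ ($T_{\mathcal O_X}$ the spherical twist). For a stability condition of $D^b_G(\mathrm{Coh}\,X)$, an object of $D^b(\mathrm{Coh}\,X)$ is called stable if its equivariant object in $D^b_G(\mathrm{Coh}\,X)$ is stable. **Central charges.** With $w(x,p)=\sum_{n\ge0}\frac{\Gamma(1+5(n+p))}{\Gamma(1+(n+p))^5}x^{n+p}$ and $J$ the hyperplane class, $Z_x(E)=\int_X\mathrm{ch}(E)\,w(x,\frac J{2\pi i})\,\mathrm{Todd}\,X$ (equivariance forgotten), analytically continued to near $x=\infty$; $Z'_x$ is the perturbation of $Z_x$ given by $Z'_x(s)=(M_\infty^{\sum s_i}\Pi_B(x))[4]+\frac15\Pi_B(x)[2]$ on simple representations, where $[j]$ is the $j$-th component, $\Pi_B={}^t(w^{(0)},w^{(1)},w^{(2)},w^{(3)})$,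 $w_k=\partial_p^kw|_{p=0}$, $w^{(0)}=w_0$, $w^{(1)}=\frac{w_1}{2\pi i}$, $w^{(2)}=\frac{5w_2}{2!(2\pi i)^2}+\frac{11}2\frac{w_1}{2\pi i}$, $w^{(3)}=-\frac{5w_3}{3!(2\pi i)^3}-\frac{50}{12}\frac{w_1}{2\pi i}$ and $$M_\infty=\begin{pmatrix}1&0&0&-1\\-1&1&0&1\\-3&-5&1&3\\5&-8&1&-4\end{pmatrix}.$$ **Stability condition.** A stability condition consists of a heart $\mathcal A$ of a bounded $t$-structure and a homomorphism $Z$ from the Grothendieck group to $\mathbb C$, with a family of nonzero semistable objects of $\mathcal A$ such that: (1) each semistable $Q$ has $Z(Q)=m(Q)\exp(\phi_Qi)$, $m(Q)>0$, $\phi_Q\in\mathbb R$; (2) $\mathrm{Ext}^1(Q,Q')\neq0$ implies $|\phi_Q-\phi_{Q'}|<\pi$; (3) $\phi_{Q'}>\phi_Q$ implies $\mathrm{Hom}(Q',Q)=0$; (4) each nonzero $E\in\mathcal A$ has a filtration $0=E_n\subset\dots\subset E_0=E$ in $\mathcal A$ with semistable $Q_i=E_i/E_{i+1}$ and $\phi_{Q_{i+1}}>\phi_{Q_i}$. Stable means semistable and not a non-trivial extension of semistable objects of the same phase. **Motivic Donaldson–Thomas invariants.** For a spherical object $S$ of the $3$-Calabi–Yau category $D^b(\mathrm{Coh}\,X)$ ($\mathrm{Ext}^i(S,S)\cong\mathbb C$ for $i=0,3$ and $0$ otherwise), the generating series of motivic Donaldson–Thomas invariants of direct sums of $S$ (Kontsevich–Soibelman),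 with motivic variable $q$, is the quantum dilogarithm $$\mathbf E(q^{1/2},z)=\sum_{m\ge0}\frac{(-q^{1/2})^{m^2}}{(q^m-1)\cdots(q^m-q^{m-1})}z^m .$$ (This is with the change of variable $q^{1/2}\mapsto-q^{1/2}$ relative to Kontsevich–Soibelman.) $\log_z$ is the formal logarithm with respect to $z$. Here $q=e^{2\pi i\tau}$, $q^{1/2}=e^{\pi i\tau}$, $\mathrm{Im}\,\tau>0$, and $$G_2(\tau)=(2\pi i)^2\Big(-\frac1{24}+\sum_{m,r>0}m\,q^{mr}\Big).$$ *)

(* Defs.v *)
From HB Require Import structures.
From mathcomp Require Import all_boot all_order all_algebra.
From mathcomp Require Import all_classical all_reals all_analysis.
From mathcomp Require Import complex.
From mathcomp Require mpoly.
From mathcomp Require Import zify.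

Set Implicit Arguments.
Unset Strict Implicit.
Unset Printing Implicit Defensive.

Import Order.TTheory GRing.Theory Num.Theory.
Import numFieldNormedType.Exports.

Local Open Scope classical_set_scope.
Local Open Scope ring_scope.

Definition dprod (K : fieldType) (I : Type) (V : I -> lmodType K) : Type :=
  forall i, V i.

HB.instance Definition _ (K : fieldType) I (V : I -> lmodType K) := gen_eqMixin (@dprod K I V).
HB.instance Definition _ (K : fieldType) I (V : I -> lmodType K) := gen_choiceMixin (@dprod K I V).

Lemma dprod_addA (K : fieldType) I (V : I -> lmodType K) :
  associative (fun (f g : @dprod K I V) => (fun i => f i + g i) : dprod V).
Proof. by move=> f g h; apply: functional_extensionality_dep => i; rewrite addrA. Qed.
Lemma dprod_addC (K : fieldType) I (V : I -> lmodType K) :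
  commutative (fun (f g : @dprod K I V) => (fun i => f i + g i) : dprod V).
Proof. by move=> f g; apply: functional_extensionality_dep => i; rewrite addrC. Qed.
Lemma dprod_add0 (K : fieldType) I (V : I -> lmodType K) : left_id ((fun=> 0) : @dprod K I V)
  (fun (f g : @dprod K I V) => (fun i => f i + g i) : dprod V).
Proof. by move=> f; apply: functional_extensionality_dep => i; rewrite add0r. Qed.
Lemma dprod_addN (K : fieldType) I (V : I -> lmodType K) :
  left_inverse ((fun=> 0) : @dprod K I V)
    (fun f : @dprod K I V => (fun i => - f i) : dprod V)
    (fun (f g : @dprod K I V) => (fun i => f i + g i) : dprod V).
Proof. by move=> f; apply: functional_extensionality_dep => i; rewrite addNr. Qed.

HB.instance Definition _ (K : fieldType) I (V : I -> lmodType K) := GRing.isZmodule.Build (@dprod K I V)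
  (@dprod_addA K I V) (@dprod_addC K I V) (@dprod_add0 K I V) (@dprod_addN K I V).

Definition dprod_scale (K : fieldType) I (V : I -> lmodType K) (a : K) (f : @dprod K I V) : dprod V :=
  fun i => a *: f i.
Lemma dprod_scaleA (K : fieldType) I (V : I -> lmodType K) a b (f : @dprod K I V) :
  dprod_scale a (dprod_scale b f) = dprod_scale (a * b) f.
Proof. by apply: functional_extensionality_dep => i; rewrite /dprod_scale scalerA. Qed.
Lemma dprod_scale1 (K : fieldType) I (V : I -> lmodType K) : left_id 1 (@dprod_scale K I V).
Proof. by move=> f; apply: functional_extensionality_dep => i; rewrite /dprod_scale scale1r. Qed.
Lemma dprod_scaleDr (K : fieldType) I (V : I -> lmodType K) : right_distributive (@dprod_scale K I V) +%R.
Proof. by move=> a f g; apply: functional_extensionality_dep => i; rewrite /dprod_scale scalerDr. Qed.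
Lemma dprod_scaleDl (K : fieldType) I (V : I -> lmodType K) (f : @dprod K I V) :
  {morph (@dprod_scale K I V)^~ f : a b / a + b}.
Proof. by move=> a b; apply: functional_extensionality_dep => i; rewrite /dprod_scale scalerDl. Qed.

HB.instance Definition _ (K : fieldType) I (V : I -> lmodType K) := GRing.Zmodule_isLmodule.Build K (@dprod K I V)
  (@dprod_scaleA K I V) (@dprod_scale1 K I V) (@dprod_scaleDr K I V)
  (@dprod_scaleDl K I V).

Lemma dprodP (K : fieldType) I (V : I -> lmodType K) (a : K) (f g : @dprod K I V) i :
  (a *: f + g) i = a *: f i + g i.
Proof. by []. Qed.

Record subsp (K : fieldType) (V : lmodType K) := Subsp {
  sp_pred :> V -> Prop;
  sp_zero : sp_pred 0;
  sp_lin : forall a u v, sp_pred u -> sp_pred v -> sp_pred (a *: u + v) }.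

Definition sp_mem (K : fieldType) (V : lmodType K) (S : @subsp K V) : {pred V} := fun x => `[< S x >].

Lemma sp_mem_closed (K : fieldType) (V : lmodType K) (S : @subsp K V) : submod_closed (sp_mem S).
Proof.
split; first by apply/asboolP; exact: sp_zero.
by move=> a u v /asboolP uS /asboolP vS; apply/asboolP; exact: sp_lin.
Qed.

HB.instance Definition _ (K : fieldType) (V : lmodType K) (S : subsp V) :=
  GRing.isSubmodClosed.Build K V (sp_mem S) (sp_mem_closed S).

Record sub_of (K : fieldType) (V : lmodType K) (S : subsp V) := SubOf {
  sub_val :> V;
  sub_valP : sub_val \in sp_mem S }.

HB.instance Definition _ (K : fieldType) (V : lmodType K) (S : subsp V) := [isSub for @sub_val K V S].
HB.instance Definition _ (K : fieldType) (V : lmodType K) (S : subsp V) := [Choice of @sub_of K V S by <:].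
HB.instance Definition _ (K : fieldType) (V : lmodType K) (S : subsp V) := [SubChoice_isSubLmodule of @sub_of K V S by <:].
Definition mk_sub (K : fieldType) (V : lmodType K) (S : subsp V) (x : V)
  (xS : S x) : sub_of S := SubOf (asboolT xS : x \in sp_mem S).

Lemma sub_ofP (K : fieldType) (V : lmodType K) (S : subsp V) (x : sub_of S) :
  S (sub_val x).
Proof. exact: (asboolW (sub_valP x)). Qed.

Lemma sub_of_eq (K : fieldType) (V : lmodType K) (S : subsp V) (x y : sub_of S) :
  sub_val x = sub_val y -> x = y.
Proof. exact: val_inj. Qed.

Lemma sub_val_lin (K : fieldType) (V : lmodType K) (S : subsp V) a (x y : sub_of S) :
  sub_val (a *: x + y) = a *: sub_val x + sub_val y.
Proof. by []. Qed.

Definition lin_iso (K : fieldType) (V W : lmodType K) : Prop :=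
  exists f : {linear V -> W}, bijective f.

Record lincat (K : fieldType) := LinCat {
  ob :> Type;
  hom : ob -> ob -> lmodType K;
  idm : forall X, hom X X;
  cmp : forall X Y Z, hom Y Z -> hom X Y -> hom X Z;
  cmpA : forall X Y Z T (h : hom Z T) (g : hom Y Z) (f : hom X Y),
    cmp h (cmp g f) = cmp (cmp h g) f;
  cmp1m : forall X Y (f : hom X Y), cmp (idm Y) f = f;
  cmpm1 : forall X Y (f : hom X Y), cmp f (idm X) = f;
  cmp_linr : forall X Y Z (g : hom Y Z) a (f f' : hom X Y),
    cmp g (a *: f + f') = a *: cmp g f + cmp g f';
  cmp_linl : forall X Y Z a (g g' : hom Y Z) (f : hom X Y),
    cmp (a *: g + g') f = a *: cmp g f + cmp g' f }.

Arguments idm {K l} X.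
Arguments cmp {K l X Y Z} g f.
Notation "g \oc f" := (cmp g f) (at level 40, left associativity).

Definition is_iso (K : fieldType) (A : lincat K) (X Y : A) (f : hom X Y) : Prop :=
  exists g : hom Y X, g \oc f = idm X /\ f \oc g = idm Y.

Definition isomorphic (K : fieldType) (A : lincat K) (X Y : A) : Prop :=
  exists f : hom X Y, is_iso f.

Definition is_zero_ob (K : fieldType) (A : lincat K) (X : A) : Prop :=
  idm X = 0.

Record lfunctor (K : fieldType) (A B : lincat K) := LFunctor {
  fob :> A -> B;
  fmor : forall X Y, hom X Y -> hom (fob X) (fob Y);
  fmor1 : forall X, fmor (idm X) = idm (fob X);
  fmorM : forall X Y Z (g : hom Y Z) (f : hom X Y),
    fmor (g \oc f) = fmor g \oc fmor f;
  fmor_lin : forall X Y a (f f' : hom X Y),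
    fmor (a *: f + f') = a *: fmor f + fmor f' }.

Arguments fmor {K A B} l {X Y} f.

Definition lfid (K : fieldType) (A : lincat K) : lfunctor A A :=
  @LFunctor K A A id (fun _ _ => id) (fun _ => erefl) (fun _ _ _ _ _ => erefl)
    (fun _ _ _ _ _ => erefl).

Program Definition lfcomp (K : fieldType) (A B C : lincat K)
    (G : lfunctor B C) (F : lfunctor A B) : lfunctor A C :=
  @LFunctor K A C (fun X => G (F X)) (fun _ _ f => fmor G (fmor F f)) _ _ _.
Next Obligation. by move=> * /=; rewrite !fmor1. Qed.
Next Obligation. by move=> * /=; rewrite !fmorM. Qed.
Next Obligation. by move=> * /=; rewrite !fmor_lin. Qed.

Record nattrans (K : fieldType) (A B : lincat K) (F G : lfunctor A B) := NatTrans {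
  ntc :> forall X, hom (F X) (G X);
  ntP : forall X Y (f : hom X Y), ntc Y \oc fmor F f = fmor G f \oc ntc X }.

Record natiso (K : fieldType) (A B : lincat K) (F G : lfunctor A B) := NatIso {
  nin :> nattrans F G;
  niP : forall X, is_iso (nin X) }.

Definition is_equivalence (K : fieldType) (A B : lincat K) (F : lfunctor A B) : Prop :=
  (forall X Y, bijective (fun f : hom X Y => fmor F f)) /\
  (forall Z : B, exists X : A, isomorphic (F X) Z).

Definition quasi_inverse (K : fieldType) (A : lincat K) (F G : lfunctor A A) : Prop :=
  inhabited (natiso (lfcomp G F) (lfid A)) /\ inhabited (natiso (lfcomp F G) (lfid A)).

Record cpx (K : fieldType) (A : lincat K) := Cpx {
  cob :> int -> A;
  cd : forall n : int, hom (cob n) (cob (n + 1));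
  cdd : forall n : int, cd (n + 1) \oc cd n = 0;
  cbd : exists N : nat, forall n : int, (N < `|n|)%N -> is_zero_ob (cob n) }.

Lemma cmp0m (K : fieldType) (A : lincat K) (X Y Z : A) (f : hom X Y) :
  (0 : hom Y Z) \oc f = 0.
Proof.
by have := cmp_linl (-1) (0 : hom Y Z) 0 f; rewrite scaler0 add0r scaleN1r addNr.
Qed.

Lemma cmpm0 (K : fieldType) (A : lincat K) (X Y Z : A) (g : hom Y Z) :
  g \oc (0 : hom X Y) = 0.
Proof.
by have := cmp_linr g (-1) (0 : hom X Y) 0; rewrite scaler0 add0r scaleN1r addNr.
Qed.

Lemma cmpmN (K : fieldType) (A : lincat K) (X Y Z : A) (g : hom Y Z) (f : hom X Y) :
  g \oc (- f) = - (g \oc f).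
Proof. by have := cmp_linr g (-1) f 0; rewrite cmpm0 !addr0 !scaleN1r. Qed.

Lemma cmpNm (K : fieldType) (A : lincat K) (X Y Z : A) (g : hom Y Z) (f : hom X Y) :
  (- g) \oc f = - (g \oc f).
Proof. by have := cmp_linl (-1) g 0 f; rewrite cmp0m !addr0 !scaleN1r. Qed.

Lemma fmor0 (K : fieldType) (A B : lincat K) (F : lfunctor A B) (X Y : A) :
  fmor F (0 : hom X Y) = 0.
Proof.
by have := fmor_lin F (-1) (0 : hom X Y) 0; rewrite scaler0 add0r scaleN1r addNr.
Qed.

Lemma fmorN (K : fieldType) (A B : lincat K) (F : lfunctor A B) (X Y : A) (f : hom X Y) :
  fmor F (- f) = - fmor F f.
Proof. by have := fmor_lin F (-1) f 0; rewrite fmor0 !addr0 !scaleN1r. Qed.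

Definition is_chain_map (K : fieldType) (A : lincat K) (X Y : cpx A)
    (f : dprod (fun n : int => hom (X n) (Y n))) : Prop :=
  forall n : int, f (n + 1) \oc cd X n = cd Y n \oc f n.

Program Definition chain_maps (K : fieldType) (A : lincat K) (X Y : cpx A) :=
  @Subsp K (dprod (fun n : int => hom (X n) (Y n))) (@is_chain_map K A X Y) _ _.
Next Obligation. by move=> K A X Y n; rewrite cmp0m cmpm0. Qed.
Next Obligation.
by move=> K A X Y a f g hf hg n; rewrite !dprodP cmp_linl cmp_linr hf hg.
Qed.

Definition chain_hom (K : fieldType) (A : lincat K) (X Y : cpx A) : lmodType K :=
  sub_of (chain_maps X Y).

Definition cmap (K : fieldType) (A : lincat K) (X Y : cpx A)
  (f : chain_hom X Y) (n : int) : hom (X n) (Y n) := sub_val f n.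

Lemma cmapP (K : fieldType) (A : lincat K) (X Y : cpx A) (f : chain_hom X Y) (n : int) :
  cmap f (n + 1) \oc cd X n = cd Y n \oc cmap f n.
Proof. exact: (sub_ofP f n). Qed.

Lemma chain_ext (K : fieldType) (A : lincat K) (X Y : cpx A) (f g : chain_hom X Y) :
  (forall n, cmap f n = cmap g n) -> f = g.
Proof. by move=> h; apply/sub_of_eq/functional_extensionality_dep. Qed.

Program Definition chain_id (K : fieldType) (A : lincat K) (X : cpx A) : chain_hom X X :=
  @mk_sub _ _ (chain_maps X X) (fun n : int => idm (X n)) _.
Next Obligation. by move=> K A X n /=; rewrite cmp1m cmpm1. Qed.

Program Definition chain_cmp (K : fieldType) (A : lincat K) (X Y Z : cpx A)
    (g : chain_hom Y Z) (f : chain_hom X Y) : chain_hom X Z :=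
  @mk_sub _ _ (chain_maps X Z) (fun n : int => cmap g n \oc cmap f n) _.
Next Obligation.
by move=> K A X Y Z g f n /=; rewrite -cmpA cmapP cmpA cmapP cmpA.
Qed.

Program Definition Chb (K : fieldType) (A : lincat K) : lincat K :=
  @LinCat K (cpx A) (@chain_hom K A) (@chain_id K A) (@chain_cmp K A) _ _ _ _ _.
Next Obligation. by move=> *; apply: chain_ext => n; rewrite /cmap /= cmpA. Qed.
Next Obligation. by move=> *; apply: chain_ext => n; rewrite /cmap /= cmp1m. Qed.
Next Obligation. by move=> *; apply: chain_ext => n; rewrite /cmap /= cmpm1. Qed.
Next Obligation. by move=> *; apply: chain_ext => n; exact: cmp_linr. Qed.
Next Obligation. by move=> *; apply: chain_ext => n; exact: cmp_linl. Qed.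

Lemma chain_map_lin (K : fieldType) (A B : lincat K) (X Y : cpx A) a
    (f g : chain_hom X Y) (n : int) : cmap (a *: f + g) n = a *: cmap f n + cmap g n.
Proof. by []. Qed.

Program Definition chain_fob (K : fieldType) (A B : lincat K) (F : lfunctor A B)
    (X : cpx A) : cpx B :=
  @Cpx K B (fun n : int => F (X n)) (fun n : int => fmor F (cd X n)) _ _.
Next Obligation. by move=> K A B F X n /=; rewrite -fmorM cdd fmor0. Qed.
Next Obligation.
move=> K A B F X; have [N hN] := cbd X; exists N => n Nn.
by rewrite /is_zero_ob -fmor1 hN // fmor0.
Qed.

Program Definition chain_fmor (K : fieldType) (A B : lincat K) (F : lfunctor A B)
    (X Y : cpx A) (f : chain_hom X Y) : chain_hom (chain_fob F X) (chain_fob F Y) :=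
  @mk_sub _ _ (chain_maps (chain_fob F X) (chain_fob F Y)) (fun n : int => fmor F (cmap f n)) _.
Next Obligation. by move=> K A B F X Y f n /=; rewrite -!fmorM cmapP. Qed.

Program Definition Chb_map (K : fieldType) (A B : lincat K) (F : lfunctor A B) :
    lfunctor (Chb A) (Chb B) :=
  @LFunctor K (Chb A) (Chb B) (chain_fob F) (@chain_fmor K A B F) _ _ _.
Next Obligation. by move=> *; apply: chain_ext => n; exact: fmor1. Qed.
Next Obligation. by move=> *; apply: chain_ext => n; exact: fmorM. Qed.
Next Obligation. by move=> *; apply: chain_ext => n; exact: fmor_lin. Qed.

Program Definition shift_fob (K : fieldType) (A : lincat K) (X : cpx A) : cpx A :=
  @Cpx K A (fun n : int => X (n + 1)) (fun n : int => - cd X (n + 1)) _ _.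
Next Obligation. by move=> K A X n /=; rewrite cmpmN cmpNm opprK cdd. Qed.
Next Obligation.
move=> K A X; have [N hN] := cbd X; exists N.+1 => n Nn.
apply: hN; move: Nn; case: n => n /=; lia.
Qed.

Program Definition shift_fmor (K : fieldType) (A : lincat K) (X Y : cpx A)
    (f : chain_hom X Y) : chain_hom (shift_fob X) (shift_fob Y) :=
  @mk_sub _ _ (chain_maps (shift_fob X) (shift_fob Y)) (fun n : int => cmap f (n + 1)) _.
Next Obligation. by move=> K A X Y f n /=; rewrite cmpmN cmpNm cmapP. Qed.

Program Definition shift (K : fieldType) (A : lincat K) : lfunctor (Chb A) (Chb A) :=
  @LFunctor K (Chb A) (Chb A) (@shift_fob K A) (@shift_fmor K A) _ _ _.
Next Obligation. by move=> *; apply: chain_ext. Qed.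
Next Obligation. by move=> *; apply: chain_ext. Qed.
Next Obligation. by move=> *; apply: chain_ext. Qed.

(** [C] with [iota : B -> C], [pi : C -> A[1]] is the mapping cone of [f : A -> B]:
    degreewise [C^n = A^(n+1) (+) B^n], with differential
    [(a, b) |-> (- d a, f a + d b)]. *)
Definition is_cone (K : fieldType) (A : lincat K) (X Y C : Chb A) (f : hom X Y)
    (iota : hom Y C) (pi : hom C (shift A X)) : Prop :=
  exists (s : forall n : int, hom ((X : cpx A) (n + 1)) ((C : cpx A) n))
         (r : forall n : int, hom ((C : cpx A) n) ((Y : cpx A) n)),
    forall n : int,
    [/\ r n \oc cmap iota n = idm _ /\ cmap pi n \oc s n = idm _,
        r n \oc s n = 0 /\ cmap pi n \oc cmap iota n = 0,
        cmap iota n \oc r n + s n \oc cmap pi n = idm _ &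
        cd (C : cpx A) n \oc s n =
          s (n + 1) \oc cd (shift A X : cpx A) n + cmap iota (n + 1) \oc cmap f (n + 1)].

Definition is_kernel (K : fieldType) (A : lincat K) (Z X Y : A)
    (z : hom Z X) (f : hom X Y) : Prop :=
  f \oc z = 0 /\
  forall (T : A) (t : hom T X), f \oc t = 0 -> exists! t' : hom T Z, z \oc t' = t.

Definition is_cokernel (K : fieldType) (A : lincat K) (X Y Z : A)
    (f : hom X Y) (z : hom Y Z) : Prop :=
  z \oc f = 0 /\
  forall (T : A) (t : hom Y T), t \oc f = 0 -> exists! t' : hom Z T, t' \oc z = t.

(** [H] is the cohomology of [X] in degree [n + 1]. *)
Definition is_cohomology (K : fieldType) (A : lincat K) (X : cpx A) (n : int)
    (Z H : A) (z : hom Z (X (n + 1))) (h : hom Z H) : Prop :=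
  is_kernel z (cd X (n + 1)) /\
  exists b : hom (X n) Z, z \oc b = cd X n /\ is_cokernel b h.

Definition quasi_iso (K : fieldType) (A : lincat K) (X Y : Chb A) (f : hom X Y) : Prop :=
  forall n : int, exists (Z H Z' H' : A)
    (z : hom Z ((X : cpx A) (n + 1))) (h : hom Z H)
    (z' : hom Z' ((Y : cpx A) (n + 1))) (h' : hom Z' H')
    (u : hom Z Z') (v : hom H H'),
    [/\ is_cohomology z h, is_cohomology z' h',
        z' \oc u = cmap f (n + 1) \oc z, h' \oc u = v \oc h & is_iso v].

Definition is_localization (K : fieldType) (A D : lincat K)
    (W : forall X Y : A, hom X Y -> Prop) (Q : lfunctor A D) : Prop :=
  [/\ forall X Y (w : hom X Y), W X Y w -> is_iso (fmor Q w),
      forall (E : lincat K) (F : lfunctor A E),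
        (forall X Y (w : hom X Y), W X Y w -> is_iso (fmor F w)) ->
        exists F' : lfunctor D E, inhabited (natiso (lfcomp F' Q) F) &
      forall (E : lincat K) (F G : lfunctor D E)
        (al : nattrans (lfcomp F Q) (lfcomp G Q)),
        exists be : nattrans F G, (forall X, be (Q X) = al X) /\
  forall be' : nattrans F G, (forall X, be' (Q X) = al X) ->
            forall Y, be' Y = be Y].

(** The bounded derived category of [A] is given by its universal property, hence
    up to equivalence; [dsh] is its shift functor. *)
Record dercat (K : fieldType) (A : lincat K) := DerCat {
  dc :> lincat K;
  dQ : lfunctor (Chb A) dc;
  dQ_loc : is_localization (@quasi_iso K A) dQ;
  dsh : lfunctor dc dc;
  dsh_Q : natiso (lfcomp dsh dQ) (lfcomp dQ (shift A)) }.

Arguments dQ {K A} d.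
Arguments dsh {K A} d.

Definition distinguished (K : fieldType) (A : lincat K) (D : dercat A) (X Y Z : D)
    (u : hom X Y) (v : hom Y Z) (w : hom Z (dsh D X)) : Prop :=
  exists (X' Y' C : Chb A) (f : hom X' Y') (iota : hom Y' C) (pi : hom C (shift A X'))
    (a : hom X (dQ D X')) (b : hom Y (dQ D Y')) (c : hom Z (dQ D C)),
    is_cone f iota pi /\ [/\ is_iso a, is_iso b & is_iso c] /\
  [/\ b \oc u = fmor (dQ D) f \oc a,
        c \oc v = fmor (dQ D) iota \oc b &
        dsh_Q D X' \oc fmor (dsh D) a \oc w = fmor (dQ D) pi \oc c].

Record trifunctor (K : fieldType) (A B : lincat K) (D : dercat A) (D' : dercat B) :=
  TriFunctor {
  tf :> lfunctor D D';
  tf_sh : natiso (lfcomp tf (dsh D)) (lfcomp (dsh D') tf);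
  tf_dist : forall (X Y Z : D) (u : hom X Y) (v : hom Y Z) (w : hom Z (dsh D X)),
    distinguished u v w ->
    distinguished (D := D') (fmor tf u) (fmor tf v) (tf_sh X \oc fmor tf w) }.

(** [F'] is induced by the exact functor [F] between abelian categories. *)
Definition is_derived_of (K : fieldType) (A B : lincat K) (D : dercat A) (D' : dercat B)
    (F : lfunctor A B) (F' : lfunctor D D') : Prop :=
  inhabited (natiso (lfcomp F' (dQ D)) (lfcomp (dQ D') (Chb_map F))).

(** The object [X] of [D^b(A)] is the object [M] of [A] placed in degree 0. *)
Definition in_degree0 (K : fieldType) (A : lincat K) (D : dercat A) (M : A) (X : D) : Prop :=
  exists C : cpx A,
    [/\ isomorphic (C 0) M, forall n : int, n != 0 -> is_zero_ob (C n) &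
        isomorphic X (dQ D C)].

Definition ext (K : fieldType) (A : lincat K) (D : dercat A) (X Y : D) (i : int) : lmodType K :=
  match i with
  | Posz n => hom X (iter n (dsh D) Y)
  | Negz n => hom (iter n.+1 (dsh D) X) Y
  end.

(** [Y] is isomorphic to [X[i]]. *)
Definition is_shift (K : fieldType) (A : lincat K) (D : dercat A) (i : int) (X Y : D) : Prop :=
  match i with
  | Posz n => isomorphic Y (iter n (dsh D) X)
  | Negz n => isomorphic (iter n.+1 (dsh D) Y) X
  end.

Definition spherical (K : fieldType) (A : lincat K) (D : dercat A) (S : D) : Prop :=
  [/\ lin_iso (ext S S 0) K^o, lin_iso (ext S S 3) K^o &
      forall i : int, i != 0 -> i != 3 -> forall f : ext S S i, f = 0].

(** [ev : P -> E] is the evaluation [RHom(O, E) (x) O -> E]: [P] is the direct sum of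
    [mlt j] copies of [Os j = O[-j]] for each [j], and for each [j] the components
    of [ev] on these copies form a basis of [Hom(O[-j], E) = Hom(O, E[j])]. *)
Definition is_evaluation (K : fieldType) (A : lincat K) (D : dercat A) (O E P : D)
    (ev : hom P E) : Prop :=
  exists (Os : int -> D) (mlt : int -> nat)
         (inj : forall j : int, 'I_(mlt j) -> hom (Os j) P),
    [/\ forall j : int, is_shift (- j) O (Os j),
        exists N : nat, forall j : int, (N < `|j|)%N -> mlt j = 0%N,
        forall (Y : D) (g : forall j : int, 'I_(mlt j) -> hom (Os j) Y),
          exists! h : hom P Y, forall j k, h \oc inj j k = g j k &
        forall (j : int) (f : hom (Os j) E),
          exists! c : 'rV[K]_(mlt j), f = \sum_k c 0 k *: (ev \oc inj j k)].

(** The spherical twist along the spherical object [O]: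
    [T E] is the cone of [RHom(O, E) (x) O -> E], naturally in [E]. *)
Definition is_spherical_twist (K : fieldType) (A : lincat K) (D : dercat A) (O : D)
    (T : trifunctor D D) : Prop :=
  [/\ spherical O, is_equivalence T &
      exists eta : nattrans (lfid D) T, forall E : D,
        exists (P : D) (ev : hom P E) (w : hom (T E) (dsh D P)),
          is_evaluation O ev /\ distinguished ev (eta E) w].

Record tstructure (K : fieldType) (A : lincat K) (D : dercat A) := TStructure {
  t_le : D -> Prop;
  t_ge : D -> Prop;
  t_le_iso : forall X Y, isomorphic X Y -> t_le X -> t_le Y;
  t_ge_iso : forall X Y, isomorphic X Y -> t_ge X -> t_ge Y;
  t_le_sh : forall X, t_le X -> t_le (dsh D X);
  t_ge_sh : forall X, t_ge (dsh D X) -> t_ge X;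
  t_hom0 : forall X Y (f : hom X Y), t_le X -> t_ge (dsh D Y) -> f = 0;
  t_dec : forall E, exists (X Y : D) (u : hom X E) (v : hom E Y) (w : hom Y (dsh D X)),
    [/\ t_le X, t_ge (dsh D Y) & distinguished u v w];
  t_bounded : forall E, (exists m, t_le (iter m (dsh D) E)) /\
  (exists m Y, t_ge Y /\ isomorphic (iter m (dsh D) Y) E) }.

Definition heart (K : fieldType) (A : lincat K) (D : dercat A) (t : tstructure D)
  (E : D) : Prop := t_le t E /\ t_ge t E.

Definition CC (R : realType) : numClosedFieldType := R[i]%C.

Definition cexp (R : realType) (z : CC R) : CC R :=
  (expR (complex.Re z) * cos (complex.Im z) +i* (expR (complex.Re z) * sin (complex.Im z)))%C.

Definition rc (R : realType) (x : R) : CC R := (x%:C)%C.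

Definition ic (R : realType) : CC R := 'i%C.

Definition twopii (R : realType) : CC R := rc (2 * pi) * ic R.

(** A stability condition on [D]. The phase and the mass of a semistable object are
    recorded as functions on all objects; their values matter only on semistable objects.
    A homomorphism from the Grothendieck group of the heart is the same as
    an additive function on [D]. *)
Record stability (R : realType) (A : lincat (CC R)) (D : dercat A) := Stability {
  st_t : tstructure D;
  st_Z : D -> CC R;
  st_Z_add : forall (X Y Z : D) (u : hom X Y) (v : hom Y Z) (w : hom Z (dsh D X)),
    distinguished u v w -> st_Z Y = st_Z X + st_Z Z;
  st_ss : D -> Prop;
  st_mass : D -> R;
  st_phase : D -> R;
  st_ss_heart : forall Q, st_ss Q -> heart st_t Q;
  st_ss_neq0 : forall Q, st_ss Q -> ~ is_zero_ob Q;
  st_ss_iso : forall Q Q', isomorphic Q Q' -> st_ss Q -> st_ss Q';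
  st_polar : forall Q, st_ss Q ->
    0 < st_mass Q /\ st_Z Q = rc (st_mass Q) * cexp (rc (st_phase Q) * ic R);
  st_ext1 : forall Q Q', st_ss Q -> st_ss Q' ->
    (exists f : ext Q Q' 1, f <> 0) -> `|st_phase Q - st_phase Q'| < pi;
  st_hom0 : forall Q Q', st_ss Q -> st_ss Q' -> st_phase Q < st_phase Q' ->
    forall f : hom Q' Q, f = 0;
  (** exact sequences [0 -> E_(i+1) -> E_i -> Q_i -> 0] of the heart are distinguished
      triangles of [D] with all three objects in the heart *)
  st_HN : forall E, heart st_t E -> ~ is_zero_ob E ->
    exists (n : nat) (F Q : nat -> D),
      [/\ F 0%N = E, is_zero_ob (F n),
          forall i, (i <= n)%N -> heart st_t (F i),
          forall i, (i < n)%N -> st_ss (Q i) /\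
            exists (u : hom (F i.+1) (F i)) (v : hom (F i) (Q i))
                   (w : hom (Q i) (dsh D (F i.+1))), distinguished u v w &
          forall i, (i.+1 < n)%N -> st_phase (Q i) < st_phase (Q i.+1)] }.

Definition stable (R : realType) (A : lincat (CC R)) (D : dercat A)
    (sg : stability D) (E : D) : Prop :=
  st_ss sg E /\
  ~ exists (B C : D) (u : hom B E) (v : hom E C) (w : hom C (dsh D B)),
      [/\ st_ss sg B, st_ss sg C,
          st_phase sg B = st_phase sg E, st_phase sg C = st_phase sg E &
          distinguished u v w].

(** [X] is the quotient of the punctured affine cone [fermat R] by scaling. Open subsets of [X]
    are encoded by their inverse images in the cone, and functions on [X] (more generally
    sections of [O(d)]) by functions on the cone. *)
Definition fermat (R : realType) : set 'rV[CC R]_5 :=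
  [set v | v != 0 /\ \sum_i v 0 i ^+ 5 = 0].

Arguments fermat : clear implicits.

Definition homog (R : realType) (d : nat) (f : mpoly.mpoly 5 (CC R)) : Prop :=
  all (fun m => mpoly.mdeg m == d) (mpoly.msupp f).

Definition peval (R : realType) (f : mpoly.mpoly 5 (CC R)) (v : 'rV[CC R]_5) : CC R :=
  mpoly.meval (fun i => v 0 i) f.

Record zopen (R : realType) := ZOpen {
  zset :> set 'rV[CC R]_5;
  zopenP : exists S : set (mpoly.mpoly 5 (CC R)),
    (forall f, S f -> exists d, homog d f) /\
    zset = fermat R `&` [set v | exists2 f, S f & peval f v != 0] }.

(** [a] is a section of [O(d)] over [U]: locally a quotient of forms of degrees [n + d], [n]. *)
Definition regular (R : realType) (d : nat) (U : zopen R) (a : 'rV[CC R]_5 -> CC R) : Prop :=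
  forall v, zset U v -> exists (V : zopen R) (n : nat) (f g : mpoly.mpoly 5 (CC R)),
    [/\ zset V v, V `<=` U, homog (n + d) f, homog n g &
        forall w, zset V w -> peval g w != 0 /\ a w = peval f w / peval g w].

(** Sheaves of [O_X]-modules. The values of [res U V] for [V] not contained in [U], and of
    [act U a] for [a] not regular on [U], are irrelevant. *)
Record omod (R : realType) := OMod {
  sec : zopen R -> lmodType (CC R);
  res : forall U V, sec U -> sec V;
  act : forall U, ('rV[CC R]_5 -> CC R) -> sec U -> sec U;
  res_lin : forall (U V : zopen R), V `<=` U -> forall c (s t : sec U),
    res V (c *: s + t) = c *: res V s + res V t;
  res_id : forall U (s : sec U), res U s = s;
  res_comp : forall (U V W : zopen R), V `<=` U -> W `<=` V -> forall s : sec U,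
    res W (res V s) = res W s;
  act_ext : forall U a b, regular 0 U a -> {in zset U, a =1 b} -> forall s : sec U,
    act a s = act b s;
  act_lin : forall U a, regular 0 U a -> forall c (s t : sec U),
    act a (c *: s + t) = c *: act a s + act a t;
  act_add : forall U a b, regular 0 U a -> regular 0 U b -> forall s : sec U,
    act (fun v => a v + b v) s = act a s + act b s;
  act_mul : forall U a b, regular 0 U a -> regular 0 U b -> forall s : sec U,
    act (fun v => a v * b v) s = act a (act b s);
  act_cst : forall U c (s : sec U), act (fun=> c) s = c *: s;
  act_res : forall (U V : zopen R) a, V `<=` U -> regular 0 U a -> forall s : sec U,
    res V (act a s) = act a (res V s);
  sheaf_sep : forall (U : zopen R) (cov : set (zopen R)),
    (forall V, cov V -> V `<=` U) -> U `<=` \bigcup_(V in cov) zset V ->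
    forall s t : sec U, (forall V, cov V -> res V s = res V t) -> s = t;
  sheaf_glue : forall (U : zopen R) (cov : set (zopen R)),
    (forall V, cov V -> V `<=` U) -> U `<=` \bigcup_(V in cov) zset V ->
    forall t : (forall V, sec V),
    (forall (V V' W : zopen R), cov V -> cov V' -> W `<=` V -> W `<=` V' ->
       res W (t V) = res W (t V')) ->
    exists s : sec U, forall V, cov V -> res V s = t V }.

Arguments sec {R} o U.
Arguments res {R o U} V s.
Arguments act {R o U} a s.

Definition is_omod_map (R : realType) (F G : omod R)
    (f : dprod (fun U : zopen R => dprod (fun _ : sec F U => sec G U))) : Prop :=
  [/\ forall U c (s t : sec F U), f U (c *: s + t) = c *: f U s + f U t,
      forall (U V : zopen R), V `<=` U -> forall s : sec F U, f V (res V s) = res V (f U s) &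
      forall U a, regular 0 U a -> forall s : sec F U, f U (act a s) = act a (f U s)].

Program Definition omod_maps (R : realType) (F G : omod R) :=
  @Subsp (CC R) (dprod (fun U : zopen R => dprod (fun _ : sec F U => sec G U)))
    (@is_omod_map R F G) _ _.
Next Obligation.
move=> R F G; split=> [U c s t|U V VU s|U a ra s].
- by rewrite scaler0 addr0.
- by have := res_lin VU (-1) (0 : sec G U) 0; rewrite scaler0 add0r scaleN1r addNr.
- by have := act_lin ra (-1) (0 : sec G U) 0; rewrite scaler0 add0r scaleN1r addNr.
Qed.
Next Obligation.
move=> R F G c f g [f1 f2 f3] [g1 g2 g3].
have E (U : zopen R) (s : sec F U) : (c *: f + g) U s = c *: f U s + g U s by [].
split=> [U b s t|U V VU s|U a ra s]; rewrite !E.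
- by rewrite f1 g1 !scalerDr !scalerA mulrC addrACA.
- by rewrite res_lin // f2 // g2.
- by rewrite act_lin // f3 // g3.
Qed.

Definition omod_hom (R : realType) (F G : omod R) : lmodType (CC R) :=
  sub_of (omod_maps F G).

Definition omap (R : realType) (F G : omod R) (f : omod_hom F G) (U : zopen R) :
  sec F U -> sec G U := sub_val f U.

Lemma omapP (R : realType) (F G : omod R) (f : omod_hom F G) :
  is_omod_map (sub_val f).
Proof. exact: (sub_ofP f). Qed.

Lemma omap_ext (R : realType) (F G : omod R) (f g : omod_hom F G) :
  (forall U s, omap f (U := U) s = omap g s) -> f = g.
Proof.
move=> h; apply/sub_of_eq/functional_extensionality_dep => U.
by apply/functional_extensionality_dep => s; exact: h.
Qed.

Program Definition omod_id (R : realType) (F : omod R) : omod_hom F F :=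
  @mk_sub _ _ (omod_maps F F) (fun U s => s) _.
Next Obligation. by move=> R F; split. Qed.

Program Definition omod_cmp (R : realType) (F G H : omod R)
    (g : omod_hom G H) (f : omod_hom F G) : omod_hom F H :=
  @mk_sub _ _ (omod_maps F H) (fun U s => omap g (omap f s)) _.
Next Obligation.
move=> R F G H g f; have [f1 f2 f3] := omapP f; have [g1 g2 g3] := omapP g.
rewrite /omap; split=> [U c s t|U V VU s|U a ra s].
- by rewrite f1 g1.
- by rewrite f2 // g2.
- by rewrite f3 // g3.
Qed.

Program Definition OModX (R : realType) : lincat (CC R) :=
  @LinCat (CC R) (omod R) (@omod_hom R) (@omod_id R) (@omod_cmp R) _ _ _ _ _.
Next Obligation. by move=> *; apply: omap_ext. Qed.
Next Obligation. by move=> *; apply: omap_ext. Qed.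
Next Obligation. by move=> *; apply: omap_ext. Qed.
Next Obligation.
by move=> R X Y Z g a f f'; apply: omap_ext => U s; have [g1 _ _] := omapP g; exact: g1.
Qed.
Next Obligation. by move=> *; apply: omap_ext. Qed.

(** Coherence in the sense of Serre: [F] is of finite type, and so is
    the sheaf of relations between any finite family of local sections. *)
Definition finite_type (R : realType) (F : omod R) : Prop :=
  forall v, fermat R v -> exists (U : zopen R) (n : nat) (s : 'I_n -> sec F U), zset U v /\
    forall (V : zopen R) (t : sec F V) w, V `<=` U -> zset V w ->
    exists (W : zopen R) (a : 'I_n -> 'rV[CC R]_5 -> CC R),
      [/\ zset W w, W `<=` V, forall i, regular 0 W (a i) &
          res W t = \sum_i act (a i) (res W (s i))].

Definition relation_on (R : realType) (F : omod R) (U : zopen R) (n : nat)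
    (s : 'I_n -> sec F U) (V : zopen R) (a : 'I_n -> 'rV[CC R]_5 -> CC R) : Prop :=
  (forall i, regular 0 V (a i)) /\ \sum_i act (a i) (res V (s i)) = 0.

Definition coherent (R : realType) (F : omod R) : Prop :=
  finite_type F /\
  forall (U : zopen R) (n : nat) (s : 'I_n -> sec F U) v, zset U v ->
  exists (V : zopen R) (k : nat) (b : 'I_k -> 'I_n -> 'rV[CC R]_5 -> CC R),
    [/\ zset V v, V `<=` U, forall j, relation_on s V (b j) &
    forall (W : zopen R) (a : 'I_n -> 'rV[CC R]_5 -> CC R) w,
      W `<=` V -> relation_on s W a -> zset W w ->
    exists (W' : zopen R) (c : 'I_k -> 'rV[CC R]_5 -> CC R),
      [/\ zset W' w, W' `<=` W, forall j, regular 0 W' (c j) &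
          forall i x, zset W' x -> a i x = \sum_j c j x * b j i x]].

Record coh (R : realType) := Coh { coh_omod :> omod R; cohP : coherent coh_omod }.

Definition CohX (R : realType) : lincat (CC R) :=
  @LinCat (CC R) (coh R) (fun F G => omod_hom F G) (fun F => omod_id F)
    (fun F G H => @omod_cmp R F G H)
    (fun F G H I => @cmpA _ (OModX R) F G H I)
    (fun F G => @cmp1m _ (OModX R) F G) (fun F G => @cmpm1 _ (OModX R) F G)
    (fun F G H => @cmp_linr _ (OModX R) F G H)
    (fun F G H => @cmp_linl _ (OModX R) F G H).

Definition zeta5 (R : realType) : CC R := cexp (twopii R / 5%:R).

Definition gmul (R : realType) (g : 'rV['Z_5]_5) (v : 'rV[CC R]_5) : 'rV[CC R]_5 :=
  \row_i (zeta5 R ^+ (g 0 i) * v 0 i).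

(** Sheaves equivariant under [G = Z_5^5 / Z_5]: translation by [g] maps sections over [U] to
    sections over [V = g U] ([gact g U V] is irrelevant for other [V]), and
    the diagonal of [Z_5^5] acts trivially. *)
Record eqcoh (R : realType) := EqCoh {
  eq_coh :> coh R;
  gact : 'rV['Z_5]_5 -> forall U V, sec eq_coh U -> sec eq_coh V;
  gact_lin : forall g (U V : zopen R), zset V = gmul g @` U -> forall c (s t : sec eq_coh U),
    gact g V (c *: s + t) = c *: gact g V s + gact g V t;
  gact_act : forall g (U V : zopen R) a, zset V = gmul g @` U -> regular 0 U a ->
    forall s : sec eq_coh U, gact g V (act a s) = act (fun v => a (gmul (- g) v)) (gact g V s);
  gact_res : forall g (U V U' V' : zopen R), zset V = gmul g @` U -> zset V' = gmul g @` U' ->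
    U' `<=` U -> forall s : sec eq_coh U, res V' (gact g V s) = gact g V' (res U' s);
  gact_mul : forall g h (U V W : zopen R), zset V = gmul g @` U -> zset W = gmul h @` V ->
    forall s : sec eq_coh U, gact h W (gact g V s) = gact (g + h) W s;
  gact_diag : forall (c : 'Z_5) U (s : sec eq_coh U), gact (const_mx c) U s = s }.

Arguments gact {R} e g {U} V s.

Definition is_eq_map (R : realType) (E F : eqcoh R) (f : omod_hom E F) : Prop :=
  forall g (U V : zopen R), zset V = gmul g @` U -> forall s : sec E U,
    omap f (gact E g V s) = gact F g V (omap f s).

Program Definition eq_maps (R : realType) (E F : eqcoh R) :=
  @Subsp (CC R) (omod_hom E F) (@is_eq_map R E F) _ _.
Next Obligation.
move=> R E F g U V VU s.
by have := gact_lin VU (-1) (0 : sec F U) 0; rewrite scaler0 add0r scaleN1r addNr.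
Qed.
Next Obligation.
move=> R E F c f f' hf hf' g U V VU s.
have H (W : zopen R) (t : sec E W) : omap (c *: f + f') t = c *: omap f t + omap f' t by [].
by rewrite !H (gact_lin VU) hf // hf'.
Qed.

Definition eq_hom (R : realType) (E F : eqcoh R) : lmodType (CC R) := sub_of (eq_maps E F).

Program Definition eq_id (R : realType) (E : eqcoh R) : eq_hom E E :=
  @mk_sub _ _ (eq_maps E E) (omod_id E) _.
Next Obligation. by []. Qed.

Program Definition eq_cmp (R : realType) (E F H : eqcoh R) (g : eq_hom F H) (f : eq_hom E F) :
    eq_hom E H :=
  @mk_sub _ _ (eq_maps E H) (omod_cmp (sub_val g) (sub_val f)) _.
Next Obligation.
move=> R E F H g f k U V VU s.
have T (W : zopen R) (t : sec E W) :
  omap (omod_cmp (sub_val g) (sub_val f)) t = omap (sub_val g) (omap (sub_val f) t) by [].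
by rewrite !T (sub_ofP f) // (sub_ofP g).
Qed.

Program Definition CohGX (R : realType) : lincat (CC R) :=
  @LinCat (CC R) (eqcoh R) (@eq_hom R) (@eq_id R) (@eq_cmp R) _ _ _ _ _.
Next Obligation. by move=> *; apply: sub_of_eq; exact: (@cmpA _ (OModX _)). Qed.
Next Obligation. by move=> *; apply: sub_of_eq; exact: (@cmp1m _ (OModX _)). Qed.
Next Obligation. by move=> *; apply: sub_of_eq; exact: (@cmpm1 _ (OModX _)). Qed.
Next Obligation. by move=> *; apply: sub_of_eq; exact: (@cmp_linr _ (OModX _)). Qed.
Next Obligation. by move=> *; apply: sub_of_eq; exact: (@cmp_linl _ (OModX _)). Qed.

Program Definition forget (R : realType) : lfunctor (CohGX R) (CohX R) :=
  @LFunctor (CC R) (CohGX R) (CohX R) (fun E => eq_coh E) (fun E F f => sub_val f) _ _ _.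
Next Obligation. by []. Qed.
Next Obligation. by []. Qed.
Next Obligation. by []. Qed.

(** [F] is free of rank one, with basis the global section [e]. *)
Definition is_structure_sheaf (R : realType) (F : omod R) : Prop :=
  exists e : (forall U, sec F U),
    (forall (U V : zopen R), V `<=` U -> res V (e U) = e V) /\
    forall U (s : sec F U), exists a, [/\ regular 0 U a, s = act a (e U) &
      forall b, regular 0 U b -> s = act b (e U) -> {in zset U, a =1 b}].

(** [nu] is an [O_X]-bilinear map [O(1) x F -> H]. *)
Definition o1_bilinear (R : realType) (F H : omod R)
    (nu : forall U, ('rV[CC R]_5 -> CC R) -> sec F U -> sec H U) : Prop :=
  [/\ forall U a b, regular 1 U a -> {in zset U, a =1 b} -> forall s, nu U a s = nu U b s,
      forall U a b, regular 1 U a -> regular 1 U b -> forall s,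
        nu U (fun v => a v + b v) s = nu U a s + nu U b s,
      forall U a, regular 1 U a -> forall s t, nu U a (s + t) = nu U a s + nu U a t,
      forall U a b, regular 1 U a -> regular 0 U b -> forall s,
        nu U (fun v => b v * a v) s = act b (nu U a s) /\
        nu U a (act b s) = act b (nu U a s) &
      forall (U V : zopen R) a, V `<=` U -> regular 1 U a -> forall s,
        res V (nu U a s) = nu V a (res V s)].

(** [mu] exhibits [F1] as the tensor product [O(1) (x) F]. *)
Definition is_tensor_O1 (R : realType) (F F1 : omod R)
    (mu : forall U, ('rV[CC R]_5 -> CC R) -> sec F U -> sec F1 U) : Prop :=
  o1_bilinear mu /\
  forall (H : omod R) (nu : forall U, ('rV[CC R]_5 -> CC R) -> sec F U -> sec H U),
    o1_bilinear nu ->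
    exists! f : omod_hom F1 H,
      forall U a s, regular 1 U a -> omap f (mu U a s) = nu U a s.

Definition is_O1_twist (R : realType) (tw : lfunctor (CohX R) (CohX R)) : Prop :=
  exists mu : (forall F : coh R, forall U, ('rV[CC R]_5 -> CC R) -> sec F U -> sec (tw F : coh R) U),
    (forall F, is_tensor_O1 (mu F)) /\
    forall (F G : CohX R) (f : hom F G) U a (s : sec (F : coh R) U), regular 1 U a ->
      omap (fmor tw f : omod_hom (tw F : coh R) (tw G : coh R)) (mu F U a s) =
        mu G U a (omap (f : omod_hom (F : coh R) (G : coh R)) s).

Definition vertex := {ffun 'I_5 -> 'I_4}.

Definition vsum (s : vertex) : nat := \sum_i s i.

Definition arrow (s t : vertex) : bool :=
  [exists i, (t i == (s i).+1 :> nat) && [forall j, (j != i) ==> (t j == s j)]].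

Record rep (K : fieldType) := Rep {
  rv : vertex -> vectType K;
  rmap : forall s t, {linear rv s -> rv t};
  rcomm : forall s t t' u, arrow s t -> arrow t u -> arrow s t' -> arrow t' u ->
    forall x, rmap t u (rmap s t x) = rmap t' u (rmap s t' x) }.

Arguments rmap {K} r s t.

Definition is_rep_map (K : fieldType) (M N : rep K)
    (f : dprod (fun s : vertex => dprod (fun _ : rv M s => rv N s : lmodType K))) : Prop :=
  (forall s c (x y : rv M s), f s (c *: x + y) = c *: f s x + f s y) /\
  (forall s t, arrow s t -> forall x, f t (rmap M s t x) = rmap N s t (f s x)).

Program Definition rep_maps (K : fieldType) (M N : rep K) :=
  @Subsp K (dprod (fun s : vertex => dprod (fun _ : rv M s => rv N s : lmodType K)))
    (@is_rep_map K M N) _ _.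
Next Obligation.
move=> K M N; split=> [s c x y|s t st x].
- by transitivity (c *: (0 : rv N s) + 0); rewrite ?scaler0 ?addr0.
- by symmetry; exact: (linear0 (rmap N s t)).
Qed.
Next Obligation.
move=> K M N c f g [f1 f2] [g1 g2].
have E (s : vertex) (x : rv M s) : (c *: f + g) s x = c *: f s x + g s x by [].
split=> [s b x y|s t st x]; rewrite !E.
- by rewrite f1 g1 !scalerDr !scalerA mulrC addrACA.
- by rewrite linearP f2 // g2.
Qed.

Definition rep_hom (K : fieldType) (M N : rep K) : lmodType K := sub_of (rep_maps M N).

Definition rapp (K : fieldType) (M N : rep K) (f : rep_hom M N) (s : vertex) :
  rv M s -> rv N s := sub_val f s.

Lemma rep_ext (K : fieldType) (M N : rep K) (f g : rep_hom M N) :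
  (forall s x, rapp f (s := s) x = rapp g x) -> f = g.
Proof.
move=> h; apply/sub_of_eq/functional_extensionality_dep => s.
by apply/functional_extensionality_dep => x; exact: h.
Qed.

Program Definition rep_id (K : fieldType) (M : rep K) : rep_hom M M :=
  @mk_sub _ _ (rep_maps M M) (fun s x => x) _.
Next Obligation. by []. Qed.

Program Definition rep_cmp (K : fieldType) (M N P : rep K) (g : rep_hom N P)
    (f : rep_hom M N) : rep_hom M P :=
  @mk_sub _ _ (rep_maps M P) (fun s x => rapp g (rapp f x)) _.
Next Obligation.
move=> K M N P g f; have [f1 f2] := sub_ofP f; have [g1 g2] := sub_ofP g.
by rewrite /rapp; split=> [s c x y|s t st x]; rewrite ?f1 ?g1 // f2 // g2.
Qed.

Program Definition modA (K : fieldType) : lincat K :=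
  @LinCat K (rep K) (@rep_hom K) (@rep_id K) (@rep_cmp K) _ _ _ _ _.
Next Obligation. by move=> *; apply: rep_ext. Qed.
Next Obligation. by move=> *; apply: rep_ext. Qed.
Next Obligation. by move=> *; apply: rep_ext. Qed.
Next Obligation.
by move=> K X Y Z g a f f'; apply: rep_ext => s x; have [g1 _] := sub_ofP g; exact: g1.
Qed.
Next Obligation. by move=> *; apply: rep_ext. Qed.

Definition is_simple_rep (K : fieldType) (s : vertex) (M : rep K) : Prop :=
  forall t, \dim (fullv : {vspace rv M t}) = (t == s).

(** [Y] is the simple representation [s], as an object of the derived category. *)
Definition is_simple (K : fieldType) (D : dercat (modA K)) (s : vertex) (Y : D) : Prop :=
  exists2 M : modA K, is_simple_rep s (M : rep K) & in_degree0 M Y.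

(** [H^even(X, Q) = Q[J]/(J^4)] with [int_X J^3 = 5] and [c_2(X) = 10 J^2];
    classes are polynomials in [J] of degree at most 3. *)
Definition todd : {poly rat} := 1 + (5%:R / 6%:R) *: 'X^2.

Definition intX (K : fieldType) (c : {poly K}) : K := 5%:R * c`_3.

Definition has_dim (K : fieldType) (V : lmodType K) (n : nat) : Prop :=
  lin_iso V 'rV[K]_n.

(** Additivity, normalization, compatibility with [O(1) (x) _] and Hirzebruch-Riemann-Roch
    for [chi(O_X, _)]; these properties determine the Chern character. *)
Definition is_chern_character (R : realType) (D : dercat (CohX R)) (OX : D)
    (L : lfunctor D D) (ch : D -> {poly rat}) : Prop :=
  [/\ forall E, (size (ch E) <= 4)%N,
      forall (X Y Z : D) (u : hom X Y) (v : hom Y Z) (w : hom Z (dsh D X)),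
        distinguished u v w -> ch Y = ch X + ch Z,
      ch OX = 1,
      forall E, ch (L E) = take_poly 4 ((\poly_(k < 4) (k`!%:R)^-1) * ch E) &
      forall E (d : int -> nat) (N : nat),
        (forall i : int, has_dim (ext OX E i) (d i)) ->
        (forall i : int, (N < `|i|)%N -> d i = 0%N) ->
        \sum_(k < N.*2.+1) (-1) ^+ (k + N) * (d (k%:Z - N%:Z))%:R = intX (ch E * todd)].

Definition Gamma (R : realType) (s : R) : R :=
  (\int[lebesgue_measure]_(t in `]0%R, +oo[) (t `^ (s - 1) * expR (- t)))%R.

(** [l = log x] fixes the branch of [x^(n+p)]; the exponent [p] is real near 0. *)
Definition wfun (R : realType) (l : CC R) (p : R) : CC R :=
  limn (series (fun n : nat =>
    rc (Gamma (1 + 5%:R * (n%:R + p)) / Gamma (1 + (n%:R + p)) ^+ 5) *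
    cexp (rc (n%:R + p) * l))).

Definition wper (R : realType) (l : CC R) (k : nat) : CC R :=
  (derive1n k (fun p => complex.Re (wfun l p)) 0 +i*
   derive1n k (fun p => complex.Im (wfun l p)) 0)%C.

(** [v] is the value at [l] of an analytic continuation of [w_0, ..., w_3], as functions of
    [log x], along a path starting in the domain of convergence [|x| < 5^(-5)]. *)
Definition continued_periods (R : realType) (l : CC R) (v : nat -> CC R) : Prop :=
  exists (gam : R -> CC R) (F : R -> nat -> CC R -> CC R) (r del : R),
    [/\ [/\ 0 < r, 0 < del, {within `[0, 1], continuous gam} & gam 1 = l],
        forall t k z, 0 <= t <= 1 -> (k < 4)%N -> `|z - gam t| < rc r -> derivable (F t k) z 1,
        forall s t k z, 0 <= s <= 1 -> 0 <= t <= 1 -> `|s - t| < del -> (k < 4)%N ->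
          `|z - gam s| < rc r -> `|z - gam t| < rc r -> F s k z = F t k z,
        forall k z, (k < 4)%N -> `|z - gam 0| < rc r ->
          `|cexp z| < 5%:R ^- 5 /\ F 0 k z = wper z k &
        forall k, (k < 4)%N -> v k = F 1 k l].

(** [int_X ch(E) w(x, J / 2 pi i) Todd X], where [w k] is the value of [w_k] at [x] and
    [c = ch(E)]. *)
Definition Zx (R : realType) (w : nat -> CC R) (c : {poly rat}) : CC R :=
  intX (map_poly ratr (c * todd) * \poly_(k < 4) (w k / (k`!%:R * twopii R ^+ k))).

Definition PiB (R : realType) (w : nat -> CC R) : 'cV[CC R]_4 :=
  let J := twopii R in
  \col_(i < 4) [:: w 0%N; w 1%N / J;
    5%:R * w 2%N / (2%:R * J ^+ 2) + 11%:R / 2%:R * (w 1%N / J);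
    - (5%:R * w 3%N / (6%:R * J ^+ 3)) - 50%:R / 12%:R * (w 1%N / J)]`_i.

Definition Minf (R : realType) : 'M[CC R]_4 :=
  \matrix_(i < 4, j < 4)
    (nth 0 (nth [::] [:: [:: 1; 0; 0; -1]; [:: -1; 1; 0; 1];
                         [:: -3; -5; 1; 3]; [:: 5; -8; 1; -4]] i) j : int)%:~R.

Definition Zx' (R : realType) (w : nat -> CC R) (s : vertex) : CC R :=
  (Minf R ^+ vsum s *m PiB w) (inord 3) 0 + 5%:R^-1 * PiB w (inord 1) 0.

(** The central charge of [sg] is [Z_x] with [x = exp l] near 0 (at distance less than [eps]),
    or [Z_x] near infinity ([|x| > 1 / eps]), or [Z'_x] near 0. *)
Definition quintic_central_charge (R : realType) (eps : R)
    (D : dercat (CohX R)) (DG : dercat (CohGX R)) (DM : dercat (modA (CC R)))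
    (For : trifunctor DG D) (Phi : trifunctor DM DG) (ch : D -> {poly rat})
    (sg : stability DG) : Prop :=
  [\/ exists l : CC R, `|cexp l| < rc eps /\
        forall E : DG, st_Z sg E = Zx (wper l) (ch (For E)),
      exists (l : CC R) (v : nat -> CC R),
        [/\ rc eps^-1 < `|cexp l|, continued_periods l v &
            forall E : DG, st_Z sg E = Zx v (ch (For E))] |
      exists l : CC R, `|cexp l| < rc eps /\
        forall (s : vertex) (Y : DM), is_simple s Y -> st_Z sg (Phi Y) = Zx' (wper l) s].

Definition qdilog (R : realType) (tau : CC R) (m : nat) : CC R :=
  let q := cexp (twopii R * tau) in
  let q2 := cexp (twopii R / 2%:R * tau) in
  (- q2) ^+ (m ^ 2) / \prod_(i < m) (q ^+ m - q ^+ i).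

(** Coefficients of the generating series of motivic Donaldson-Thomas invariants of
    the direct sums of the spherical object [S], with [q = exp(2 pi i tau)]. *)
Definition mdt_series (R : realType) (A : lincat (CC R)) (D : dercat A) (S : D)
  (hS : spherical S) (tau : CC R) : nat -> CC R := qdilog tau.

(** Coefficients of [log(1 + u) = u - u^2/2 + u^3/3 - ...] for the formal power series
    [1 + u] with coefficients [e] and constant term 1. *)
Definition formal_log (K : fieldType) (e : nat -> K) (n : nat) : K :=
  (\sum_(1 <= j < n.+1) ((-1) ^+ j.-1 / j%:R) *: (\poly_(m < n.+1) e m - 1) ^+ j)`_n.

Definition G2 (R : realType) (tau : CC R) : CC R :=
  twopii R ^+ 2 * (- (24%:R^-1) +
    limn (series (fun m : nat => limn (series (fun r : nat =>
      m.+1%:R * cexp (twopii R * tau) ^+ (m.+1 * r.+1)))))).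

(** [f] is the sum near [t = t0] of the series with coefficients [e] in [z = exp(2 pi i t)],
    and its second complex derivative at [t0] is [d]. *)
Definition second_tau_derivative (R : realType) (e : nat -> CC R) (t0 d : CC R) : Prop :=
  let u t := series (fun k : nat => e k * cexp (twopii R * t) ^+ k) in
  let f t : CC R := limn (u t) in
  [/\ \forall t \near t0, cvgn (u t), \forall t \near t0, derivable f t 1,
      derivable (derive1 f) t0 1 & derive1n 2 f t0 = d].

(* Main.v *)
(** Every stable object is, after forgetting the equivariance, isomorphic to
    some [tau_0^(-n) O_X]. As [tau_0] is an equivalence commuting with the shift,
    these objects are spherical because [O_X] is.

    With [y = q^(1/2)], the coefficient of [z^m] in the quantum dilogarithm is
    [y^m / ((1 - q) ... (1 - q^m))], and comparing logarithmic derivatives gives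
    [log E = sum_(k > 0) y^k z^k / (k (1 - q^k))], which converges for [|z| < 1 / |y|].
    Each [d / d tau'] multiplies the k-th term by [2 pi i k], so the second derivative at
    [z = 1] is [(2 pi i)^2 sum_k k y^k / (1 - q^k)]. As
    [y^k / (1 - q^k) = y^k / (1 - y^k) - q^k / (1 - q^k)] for [q = y^2], this is
    the difference of the Lambert series of [G2 (tau / 2)] and [G2 tau]. *)
Require Import Defs.
From HB Require Import structures.
From mathcomp Require Import all_boot all_order all_algebra.
From mathcomp Require Import all_classical all_reals all_analysis.
From mathcomp Require Import complex.
From mathcomp Require Import zify ring lra.

Import Order.TTheory GRing.Theory Num.Theory.
Import numFieldNormedType.Exports.

Local Open Scope classical_set_scope.
Local Open Scope ring_scope.

Set Implicit Arguments.
Unset Strict Implicit.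

(** * Spherical objects and equivalences *)

Lemma lin_isoI (K : fieldType) (V W : lmodType K) (f : V -> W) :
  (forall a u v, f (a *: u + v) = a *: f u + f v) -> bijective f -> lin_iso V W.
Proof.
move=> flin fbij.
pose F : {linear V -> W} := HB.pack f (GRing.isLinear.Build K V W *:%R f flin).
by exists F.
Qed.

Lemma lin_iso_trans (K : fieldType) (U V W : lmodType K) :
  lin_iso U V -> lin_iso V W -> lin_iso U W.
Proof.
move=> [f fb] [g gb]; apply: (@lin_isoI _ _ _ (g \o f)); last exact: bij_comp.
by move=> a u v; rewrite /= !linearP.
Qed.

Lemma lin_iso_eq0 (K : fieldType) (V W : lmodType K) :
  lin_iso V W -> (forall w : W, w = 0) -> forall v : V, v = 0.
Proof. by move=> [f [g fK _]] W0 v; rewrite -[v]fK [f v]W0 -(W0 (f 0)) fK. Qed.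

Lemma isomorphic_refl (K : fieldType) (A : lincat K) (X : A) : isomorphic X X.
Proof. by exists (idm X), (idm X); rewrite cmp1m. Qed.

Lemma isomorphic_trans (K : fieldType) (A : lincat K) (X Y Z : A) :
  isomorphic X Y -> isomorphic Y Z -> isomorphic X Z.
Proof.
move=> [f [f' [f'f ff']]] [g [g' [g'g gg']]].
exists (g \oc f), (f' \oc g'); split.
- by rewrite cmpA -(cmpA f') g'g cmpm1.
- by rewrite cmpA -(cmpA g) ff' cmpm1.
Qed.

Lemma isomorphic_fob (K : fieldType) (A B : lincat K) (F : lfunctor A B) (X Y : A) :
  isomorphic X Y -> isomorphic (F X) (F Y).
Proof.
move=> [f [g [gf fg]]]; exists (fmor F f), (fmor F g).
by rewrite -!fmorM gf fg !fmor1.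
Qed.

Lemma isomorphic_iter (K : fieldType) (A : lincat K) (F : lfunctor A A) n (X Y : A) :
  isomorphic X Y -> isomorphic (iter n F X) (iter n F Y).
Proof. by move=> XY; elim: n => //= n; exact: isomorphic_fob. Qed.

Lemma isomorphic_natiso (K : fieldType) (A B : lincat K) (F G : lfunctor A B) :
  natiso F G -> forall X, isomorphic (F X) (G X).
Proof. by move=> al X; exists (al X); exact: niP. Qed.

Lemma hom_lin_iso (K : fieldType) (A : lincat K) (X X' Y Y' : A) :
  isomorphic X X' -> isomorphic Y Y' -> lin_iso (Defs.hom X Y) (Defs.hom X' Y').
Proof.
move=> [f [f' [f'f ff']]] [g [g' [g'g gg']]].
apply: (@lin_isoI _ _ _ (fun h : Defs.hom X Y => g \oc h \oc f')).
  by move=> a u v; rewrite cmp_linr cmp_linl.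
exists (fun h : Defs.hom X' Y' => g' \oc h \oc f) => h.
- by rewrite !cmpA g'g cmp1m -cmpA f'f cmpm1.
- by rewrite !cmpA gg' cmp1m -cmpA ff' cmpm1.
Qed.

Lemma ext_isomorphic (K : fieldType) (A : lincat K) (D : dercat A) (X X' Y Y' : D) i :
  isomorphic X X' -> isomorphic Y Y' -> lin_iso (ext X Y i) (ext X' Y' i).
Proof.
move=> XX YY; case: i => n; apply: hom_lin_iso => //; exact: isomorphic_iter.
Qed.

Lemma iter_shift_functor (K : fieldType) (A B : lincat K) (D : dercat A) (D' : dercat B)
    (F : lfunctor D D') :
  (forall X, isomorphic (F (dsh D X)) (dsh D' (F X))) ->
  forall n X, isomorphic (F (iter n (dsh D) X)) (iter n (dsh D') (F X)).
Proof.
move=> Fsh n X; elim: n => [|n IH] /=; first exact: isomorphic_refl.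
exact/(isomorphic_trans (Fsh _))/isomorphic_fob.
Qed.

(** Full faithfulness is a linear bijection on Hom spaces, and the shifts inside [ext] (on the
    second argument for [i >= 0], on the first for [i < 0]) move through [F] object by object. *)
Lemma ext_equivalence (K : fieldType) (A B : lincat K) (D : dercat A) (D' : dercat B)
    (F : lfunctor D D') :
  is_equivalence F -> (forall X, isomorphic (F (dsh D X)) (dsh D' (F X))) ->
  forall X Y i, lin_iso (ext X Y i) (ext (F X) (F Y) i).
Proof.
move=> [Fff _] Fsh X Y i.
have homF (U V : D) : lin_iso (Defs.hom U V) (Defs.hom (F U) (F V)).
  by apply: lin_isoI (Fff U V) => *; exact: fmor_lin.
by case: i => n; apply: lin_iso_trans (homF _ _) _; apply: hom_lin_iso;
  (exact: isomorphic_refl || exact: iter_shift_functor).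
Qed.

Lemma spherical_ext (K : fieldType) (A B : lincat K) (D : dercat A) (D' : dercat B)
    (X : D) (Y : D') :
  (forall i, lin_iso (ext X X i) (ext Y Y i)) -> spherical Y -> spherical X.
Proof.
move=> XY [Y0 Y3 Yi]; split; [exact: lin_iso_trans (XY _) Y0|exact: lin_iso_trans (XY _) Y3|].
by move=> i i0 i3; apply: lin_iso_eq0 (XY i) _; exact: Yi.
Qed.

Lemma spherical_isomorphic (K : fieldType) (A : lincat K) (D : dercat A) (X Y : D) :
  isomorphic X Y -> spherical Y -> spherical X.
Proof. by move=> XY; apply: spherical_ext => i; exact: ext_isomorphic. Qed.

(** Applying [F] to [G X] returns to [X], so [Ext(G X, G X) = Ext(F G X, F G X) = Ext(X, X)].
    Compatibility with the shift is thus asked of [F] and not of [G]. *)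
Lemma spherical_quasi_inverse (K : fieldType) (A : lincat K) (D : dercat A)
    (F G : lfunctor D D) :
  is_equivalence F -> (forall X, isomorphic (F (dsh D X)) (dsh D (F X))) ->
  quasi_inverse F G -> forall X, spherical X -> spherical (G X).
Proof.
move=> Feq Fsh [_ [FG]] X sX.
apply: spherical_ext (spherical_isomorphic (isomorphic_natiso FG X) sX) => i.
exact: ext_equivalence.
Qed.

(** * The logarithm of the quantum dilogarithm *)

(* The hypothesis is [e' = e * l'], which determines [l] up to its constant term. *)
Lemma formal_log_rec (K : numFieldType) (e l : nat -> K) :
  e 0%N = 1 ->
  (forall n, n.+1%:R * e n.+1 = \sum_(k < n.+1) e (n - k)%N * (k.+1%:R * l k.+1)) ->
  forall n, formal_log e n.+1 = l n.+1.
Proof.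
move=> e0 el n; rewrite /formal_log.
set u : {poly K} := \poly_(m < n.+2) e m - 1.
set L : {poly K} := \sum_(1 <= j < n.+2) _.
have uE k : (k <= n.+1)%N -> (1 + u)`_k = e k.
  by move=> kn; rewrite /u addrC subrK coef_poly ltnS kn.
have u0 : u.[0] = 0.
  by rewrite horner_coef0 /u coefB coef1 coef_poly /= e0 subrr.
have [v uv] : exists v, u = v * 'X.
  have /factor_theorem[v] : root u 0 by rewrite /root u0.
  by rewrite polyC0 subr0 => ->; exists v.
(* The derivative of the truncated logarithm is a geometric sum in [- u] times [u'], so multiplying
   by [1 + u] telescopes. As [u] is divisible by ['X], the error starts in degree [n.+1]. *)
have LE : (1 + u) * L^`() = u^`() - ((- v) ^+ n.+1 * u^`()) * 'X^(n.+1).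
  have -> : L^`() = (\sum_(j < n.+1) (- u) ^+ j) * u^`().
    rewrite /L big_add1 /= big_mkord raddf_sum mulr_suml; apply: eq_bigr => j _.
    rewrite /= derivZ deriv_exp /= -[X in _ *: X]scaler_nat scalerA divfK ?pnatr_eq0 //.
    by rewrite -[- u]scaleN1r exprZn -scalerAl mulrC.
  rewrite mulrA -[1 + u]opprK [- (1 + u)]opprD mulNr addrC -subrX1.
  by rewrite uv -mulNr exprMn_comm; [ring|exact: commr_polyX].
have recL k : (k <= n)%N -> \sum_(j < k.+1) e (k - j)%N * L^`()`_j = k.+1%:R * e k.+1.
  move=> kn; have := congr1 (fun p : {poly K} => p`_k) LE.
  rewrite coefB coefMXn ltnS kn subr0 coef_deriv -[in RHS]mulr_natl.
  have -> : u`_k.+1 = e k.+1 by rewrite -(uE k.+1) // [RHS]coefD coef1 add0r.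
  rewrite coefMr => <-; apply: eq_bigr => j _.
  by rewrite uE ?(leq_trans (leq_subr _ _)) 1?leqW.
(* The coefficients of [L'] and the numbers [k.+1%:R * l k.+1] solve the same triangular recursion,
   in which the newest unknown has coefficient [e 0 = 1]. *)
have dL k : (k <= n)%N -> L^`()`_k = k.+1%:R * l k.+1.
  elim/ltn_ind: k => k IH kn; have := recL k kn; rewrite el !big_ord_recr /=.
  rewrite subnn e0 !mul1r (eq_bigr (fun j : 'I_k => e (k - j)%N * (j.+1%:R * l j.+1))).
    by move/addrI.
  by move=> j _; rewrite IH // ltnW // (leq_trans (ltn_ord j)).
have := dL n (leqnn n); rewrite coef_deriv -[X in X = _]mulr_natl.
by move/mulfI=> -> //; rewrite pnatr_eq0.
Qed.

(** Euler's coefficients: for [|q| < 1] their generating series is the expansion of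
    [\prod_(i >= 0) (1 - y q^i z)^-1]. Here [y] is independent of [q]. *)
Definition qexp (K : fieldType) (q y : K) (m : nat) : K :=
  y ^+ m / \prod_(i < m) (1 - q ^+ i.+1).

Lemma qexp_rec (K : fieldType) (q y : K) : (forall m, q ^+ m.+1 != 1) ->
  forall m, (1 - q ^+ m.+1) * qexp q y m.+1 = y * qexp q y m.
Proof.
move=> q1 m; rewrite /qexp big_ord_recr /= [y ^+ _]exprS.
have h : \prod_(i < m) (1 - q ^+ i.+1) != 0.
  by apply/prodf_neq0 => i _; rewrite subr_eq0 eq_sym.
have h' : 1 - q ^+ m.+1 != 0 by rewrite subr_eq0 eq_sym.
by field; rewrite h h'.
Qed.

(* With [A n] the right-hand side, [(1 - q^(n+1)) A n = y (qexp q y n + A (n-1))]. *)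
Lemma qexp_log_deriv (K : fieldType) (q y : K) : (forall m, q ^+ m.+1 != 1) ->
  forall n, n.+1%:R * qexp q y n.+1 =
    \sum_(k < n.+1) qexp q y (n - k) * (y ^+ k.+1 / (1 - q ^+ k.+1)).
Proof.
move=> q1 n; have q1' k : 1 - q ^+ k.+1 != 0 by rewrite subr_eq0 eq_sym.
apply: (mulfI (q1' n)).
elim: n => [|n IH].
  rewrite big_ord1 /= mulrCA qexp_rec // subnn /qexp big_ord0; field.
  by rewrite oner_eq0 -[q]expr1 q1'.
rewrite mulrCA qexp_rec //.
(* With [Q = q^(k+1)] and [P = q^(n+1-k)], write [1 - Q P = (1 - Q) + Q (1 - P)]: the first part
   cancels the denominator, the second prepares [qexp_rec]. The second part vanishes at [k = n+1],
   where [P = 1]. *)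
have E (k : 'I_n.+2) : (1 - q ^+ n.+2) * (qexp q y (n.+1 - k) * (y ^+ k.+1 / (1 - q ^+ k.+1)))
   = qexp q y (n.+1 - k) * y ^+ k.+1 +
     (1 - q ^+ (n.+1 - k)) * qexp q y (n.+1 - k) * (y ^+ k.+1 * q ^+ k.+1 / (1 - q ^+ k.+1)).
  have -> : q ^+ n.+2 = q ^+ k.+1 * q ^+ (n.+1 - k).
    by rewrite -exprD addSn subnKC // -ltnS.
  set Q := q ^+ k.+1; field; exact: q1'.
rewrite mulr_sumr (eq_bigr _ (fun k _ => E k)) big_split /=.
rewrite [X in _ + X]big_ord_recr /= subnn expr0 subrr !mul0r addr0.
(* Apply [qexp_rec], then [Q / (1 - Q) = 1 / (1 - Q) - 1]. Shifted by one index, the subtracted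
   terms cancel the first sum except for its term [k = 0]. *)
have E' (k : 'I_n.+1) : (1 - q ^+ (n.+1 - k)) * qexp q y (n.+1 - k) *
    (y ^+ k.+1 * q ^+ k.+1 / (1 - q ^+ k.+1)) =
    y * (qexp q y (n - k) * (y ^+ k.+1 / (1 - q ^+ k.+1))) - qexp q y (n - k) * y ^+ k.+2.
  have kn : (k <= n)%N by rewrite -ltnS.
  rewrite subSn // qexp_rec // [y ^+ k.+2]exprS; field; exact: q1'.
rewrite (eq_bigr _ (fun k _ => E' k)) sumrB -mulr_sumr.
move/mulfI: IH => <- //; rewrite [X in _ = X + _]big_ord_recl /= subn0 expr1.
under [X in _ = _ + X + _]eq_bigr do rewrite /bump /= add1n subSS.
by rewrite -[n.+2%:R]natr1; ring.
Qed.

Lemma qdilog_qexp (R : realType) (tau : CC R)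
    (q := cexp (twopii R * tau)) (y := cexp (twopii R / 2%:R * tau)) :
  y ^+ 2 = q -> q != 0 -> (forall m, q ^+ m.+1 != 1) -> qdilog tau =1 qexp q y.
Proof.
move=> yq q0 q1 m; rewrite /qdilog -/q -/y /qexp.
(* This is [m^2 = m + 2 (0 + ... + (m-1))] in the exponent, with [y^2 = q]. *)
have yE : y ^+ (m ^ 2) = y ^+ m * \prod_(i < m) q ^+ i.
  elim: m => [|m IH]; first by rewrite big_ord0 mulr1.
  rewrite big_ord_recr /= mulrA [y ^+ m.+1]exprSr [_ * y * _]mulrAC -IH -yq -exprM -exprSr -exprD.
  by congr (_ ^+ _); lia.
have h : \prod_(i < m) (1 - q ^+ i.+1) != 0.
  by apply/prodf_neq0 => i _; rewrite subr_eq0 eq_sym.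
have h' : \prod_(i < m) q ^+ i != 0.
  by apply/prodf_neq0 => i _; rewrite expf_neq0.
(* Each factor is [- q^i (1 - q^(m-i))]; reversing the index orders the last factors. The sign
   [(-1)^m] then cancels that of [(- y)^(m^2)], since [m^2] and [m] have the same parity. *)
have -> : \prod_(i < m) (q ^+ m - q ^+ i) =
    (-1) ^+ m * (\prod_(i < m) q ^+ i * \prod_(i < m) (1 - q ^+ i.+1)).
  rewrite [\prod_(i < m) (1 - _)](reindex_inj rev_ord_inj) /= -big_split /=.
  rewrite -[m in (-1) ^+ m]card_ord -prodrN; apply: eq_bigr => i _.
  by rewrite -subSn // subSS mulrBr mulr1 -exprD subnKC ?opprB // ltnW.
rewrite [(- y) ^+ _]exprNn -(signr_odd _ (m ^ 2)) oddX /= signr_odd yE; field.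
by rewrite h h' signr_eq0.
Qed.

(** * Complex series and derivatives *)

(** A division-free form of differentiability that allows [h = 0]. Over [CC R], [0 < e] means that
    [e] is a positive real. *)
Lemma is_derive1P (K : numFieldType) (f : K -> K) (x d : K) :
  is_derive x 1 f d <-> forall e, 0 < e -> exists2 del, 0 < del &
    forall h, `|h| < del -> `|f (x + h) - f x - h * d| <= e * `|h|.
Proof.
split=> [[fx fd] e e0|H].
- have /cvgrPdist_le /(_ e e0) : (fun h => h^-1 *: ((f \o shift x) (h *: 1) - f x)) @ 0^' --> d.
    by rewrite -fd; exact: fx.
  move=> [del /= del0 Hd]; exists del => // h hd.
  have [->|h0] := eqVneq h 0; first by rewrite addr0 subrr mul0r subrr !normr0 mulr0.
  have := Hd h; rewrite /ball_ /= sub0r normrN => /(_ hd h0).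
  rewrite [_ *: _](_ : _ = (f (x + h) - f x) / h); last first.
    by rewrite /= [h%:A]mulr1 [h + x]addrC [LHS]mulrC.
  rewrite distrC -[X in _ <= X -> _]mulr1 -{1}(mulfV (x := `|h|)) ?normr_eq0 //.
  rewrite mulrA ler_pdivlMr ?normr_gt0 // -normrM mulrBl divfK //.
  by rewrite [d * h]mulrC.
- have H' : (fun h => h^-1 *: ((f \o shift x) (h *: 1) - f x)) @ 0^' --> d.
    apply/cvgrPdist_le => e e0; have [del del0 Hd] := H e e0.
    exists del => //= h; rewrite /ball_ /= sub0r normrN => hd h0.
    rewrite [_ *: _](_ : _ = (f (x + h) - f x) / h); last first.
      by rewrite /= [h%:A]mulr1 [h + x]addrC [LHS]mulrC.
    rewrite distrC -(ler_pM2r (x := `|h|)) ?normr_gt0 // -normrM mulrBl divfK //.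
    by rewrite [d * h]mulrC; exact: Hd.
  apply: DeriveDef; first by apply/cvg_ex; exists d.
  exact: cvg_lim H'.
Qed.

Lemma is_derive1_continuous (K : numFieldType) (f : K -> K) (x d : K) :
  is_derive x 1 f d -> f @ x --> f x.
Proof. by move=> [fx _]; exact/differentiable_continuous/derivable1_diffP. Qed.

Lemma is_derive1_chain (K : numFieldType) (f g : K -> K) (x a b : K) :
  is_derive x 1 f a -> is_derive (f x) 1 g b -> is_derive x 1 (g \o f) (b * a).
Proof.
move=> [fx <-] [gx <-].
move: (fx) (gx) => /derivable1_diffP df /derivable1_diffP dg.
apply: DeriveDef; first exact/derivable1_diffP/differentiable_comp.
rewrite -!derive1E derive1E'; last exact/differentiable_comp.
rewrite diff_comp // !derive1E' //= -[X in 'd  _ _ X = _]mulr1.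
by rewrite [LHS]linearZ mulrC.
Qed.

Lemma ge0_rc (R : realType) (z : CC R) : 0 <= z -> exists2 x : R, 0 <= x & z = rc x.
Proof.
move=> z0; have x0 := z0; move: z0.
by case: z x0 => a b _; rewrite lecE /= => /andP[/eqP -> a0]; exists a.
Qed.

Lemma norm_rc (R : realType) (x : R) : `|rc x| = rc `|x|.
Proof. by rewrite normc_def /= expr0n addr0 sqrtr_sqr. Qed.

Lemma Re_le_norm (R : realType) (z : CC R) : rc `|complex.Re z| <= `|z|.
Proof.
rewrite normc_def lecR -sqrtr_sqr ler_wsqrtr // lerDl; exact: sqr_ge0.
Qed.

Lemma Im_le_norm (R : realType) (z : CC R) : rc `|complex.Im z| <= `|z|.
Proof.
rewrite normc_def lecR -sqrtr_sqr ler_wsqrtr // lerDr; exact: sqr_ge0.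
Qed.

Lemma normc_ic (R : realType) : `|ic R| = 1.
Proof. by rewrite normc_def /= expr0n add0r expr1n sqrtr1. Qed.

Lemma rcD (R : realType) (x y : R) : rc (x + y) = rc x + rc y.
Proof. by rewrite /rc rmorphD. Qed.

Lemma rcM (R : realType) (x y : R) : rc (x * y) = rc x * rc y.
Proof. by rewrite /rc rmorphM. Qed.

Lemma rcX (R : realType) (x : R) n : rc (x ^+ n) = rc x ^+ n.
Proof. by rewrite /rc rmorphXn. Qed.

Lemma Re_sum (R : realType) n (u : nat -> CC R) :
  complex.Re (\sum_(0 <= k < n) u k) = \sum_(0 <= k < n) complex.Re (u k).
Proof. by elim/big_rec2: _ => // k x [a b] _ <-; case: (u k). Qed.

Lemma Im_sum (R : realType) n (u : nat -> CC R) :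
  complex.Im (\sum_(0 <= k < n) u k) = \sum_(0 <= k < n) complex.Im (u k).
Proof. by elim/big_rec2: _ => // k x [a b] _ <-; case: (u k). Qed.

Lemma norm_le_ReIm (R : realType) (z : CC R) : `|z| <= rc (`|complex.Re z| + `|complex.Im z|).
Proof.
rewrite [z in `|z|]complexE (le_trans (ler_normD _ _)) // normrM.
have -> : `|'i%C : CC R| = 1 by exact: normc_ic.
by rewrite mul1r rcD -!norm_rc.
Qed.

Lemma cvgn_ReIm (R : realType) (u : nat -> CC R) (a b : R) :
  (fun n => complex.Re (u n)) @ \oo --> a -> (fun n => complex.Im (u n)) @ \oo --> b ->
  u @ \oo --> ((a +i* b)%C : CC R).
Proof.
move=> /cvgrPdist_le ua /cvgrPdist_le ub; apply/cvgrPdist_le => e e0.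
have [x x0 ex] := ge0_rc (ltW e0); move: e0; rewrite ex ltcR => e0.
have e2 : 0 < x / 2 by rewrite divr_gt0.
near=> n; apply: le_trans (norm_le_ReIm _) _; rewrite lecR [leRHS]splitr.
have -> : complex.Re ((a +i* b)%C - u n) = a - complex.Re (u n) by case: (u n).
have -> : complex.Im ((a +i* b)%C - u n) = b - complex.Im (u n) by case: (u n).
by apply: lerD; near: n; [exact: ua|exact: ub].
Unshelve. all: by end_near. Qed.

(** The comparison test is applied to the real and imaginary parts separately; the bound on the
    limit is inherited from the partial sums. *)
Lemma cvgn_series_geometric (R : realType) (u : nat -> CC R) (M x : CC R) :
  0 <= x < 1 -> (forall k, `|u k| <= M * x ^+ k) ->
  cvgn (series u) /\ `|limn (series u)| <= M / (1 - x).
Proof.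
move=> /andP[x0 x1] uM.
have M0 : 0 <= M by have := le_trans (normr_ge0 _) (uM 0%N); rewrite mulr1.
have uc : cvgn (series u).
  have [m m0 Mm] := ge0_rc M0; have [r r0 xr] := ge0_rc x0.
  move: x1 uM; rewrite xr Mm -[1]/(rc 1) ltcR => r1 uM.
  have C (v : nat -> R) : (forall k, rc `|v k| <= `|u k|) -> cvgn (series v).
    move=> vu; apply: normed_cvg.
    apply: (@series_le_cvg _ _ (geometric m r)) => [n||n|] /=.
    - exact: normr_ge0.
    - by move=> n; rewrite mulr_ge0 ?exprn_ge0.
    - by have := le_trans (vu n) (uM n); rewrite -rcX -rcM lecR.
    - by apply: is_cvg_geometric_series; rewrite ger0_norm.
  have /cvg_ex[a ua] := C (fun k => complex.Re (u k)) (fun k => Re_le_norm (u k)).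
  have /cvg_ex[b ub] := C (fun k => complex.Im (u k)) (fun k => Im_le_norm (u k)).
  apply/cvg_ex; exists (a +i* b)%C; apply: cvgn_ReIm.
  - by under eq_fun do rewrite Re_sum.
  - by under eq_fun do rewrite Im_sum.
split=> //.
have sM n : `|series u n| <= M / (1 - x).
  rewrite (le_trans (ler_norm_sum _ _ _)) //.
  rewrite (le_trans (ler_sum _ (fun k _ => uM k))) // -mulr_sumr ler_wpM2l //.
  rewrite big_mkord -[leRHS]mul1r ler_pdivlMr ?subr_gt0 // mulrC -opprB mulNr -subrX1 opprB.
  by rewrite lerBlDr lerDl exprn_ge0.
set L := limn _; set B := M / _ in sM *.
(* The order of [CC R] is partial, so comparability must be established before splitting into cases.
   If [B < |L|], a partial sum closer to [L] than [|L| - B] would exceed [B]. *)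
have LB : `|L| >=< B.
  rewrite real_comparable ?normr_real // ger0_real //.
  exact: le_trans (normr_ge0 _) (sM 0%N).
have [//|{}LB] := comparable_leP LB.
have /cvgrPdist_lt /(_ (`|L| - B)) := (uc : series u @ \oo --> L).
rewrite subr_gt0 => /(_ LB)[n _ /(_ n (leqnn n))] /=.
move=> h; suff : `|L| - B < `|L| - B by rewrite ltxx.
apply: le_lt_trans h; rewrite lerBlDr (le_trans _ (lerD (lexx _) (sM n))) //.
by rewrite -{1}[L](subrK (series u n)) ler_normD.
Qed.

(** * Power series with geometrically bounded coefficients *)

Definition geom_bounded (K : numFieldType) (a : nat -> K) (rho : K) : Prop :=
  exists M, forall k, `|a k| <= M * rho ^+ k.

Lemma geom_bounded_ge0 (K : numFieldType) (a : nat -> K) (rho : K) :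
  geom_bounded a rho -> exists2 M, 0 <= M & forall k, `|a k| <= M * rho ^+ k.
Proof.
move=> [M aM]; exists M => //.
by have := le_trans (normr_ge0 _) (aM 0%N); rewrite mulr1.
Qed.

Lemma geom_boundedZ (K : numFieldType) (a : nat -> K) (rho c : K) :
  geom_bounded a rho -> geom_bounded (fun k => c * a k) rho.
Proof.
by move=> [M aM]; exists (`|c| * M) => k; rewrite normrM -mulrA ler_wpM2l.
Qed.

Lemma geom_bounded_le (K : numFieldType) (a b : nat -> K) (rho : K) :
  (forall k, `|b k| <= `|a k|) -> geom_bounded a rho -> geom_bounded b rho.
Proof. by move=> ba [M aM]; exists M => k; exact: le_trans (aM k). Qed.

(** [y^k - x^k] is [y - x] times a sum of [k] monomials, each at least [x^(k-1)]. It lets a factor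
    [k] be absorbed by enlarging the ratio from [x] to [y]. *)
Lemma natmul_exp_le (K : numFieldType) (x y : K) k : 0 <= x <= y ->
  k%:R * x ^+ k * (y - x) <= x * (y ^+ k - x ^+ k).
Proof.
move=> /andP[x0 xy]; elim: k => [|k IH]; first by rewrite !mul0r !expr0 subrr mulr0.
have -> : k.+1%:R * x ^+ k.+1 * (y - x) =
    x * (k%:R * x ^+ k * (y - x)) + x ^+ k.+1 * (y - x).
  by rewrite -natr1 exprS; ring.
apply: le_trans (lerD (ler_wpM2l x0 IH) (lexx _)) _; rewrite -subr_ge0.
have -> : x * (y ^+ k.+1 - x ^+ k.+1) - (x * (x * (y ^+ k - x ^+ k)) + x ^+ k.+1 * (y - x)) =
    x * ((y - x) * (y ^+ k - x ^+ k)) by rewrite !exprS; ring.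
by rewrite !mulr_ge0 // ?subr_ge0 // lerXn2r ?nnegrE // (le_trans x0).
Qed.

Lemma geom_boundedMn (K : numFieldType) (a : nat -> K) (rho rho' : K) :
  0 <= rho < rho' -> geom_bounded a rho -> geom_bounded (fun k => k%:R * a k) rho'.
Proof.
move=> /andP[r0 rr'] /geom_bounded_ge0[M M0 aM]; exists (M * (rho / (rho' - rho))) => k.
rewrite normrM normr_nat (le_trans (ler_wpM2l _ (aM k))) // mulrCA -mulrA ler_wpM2l //.
rewrite mulrAC ler_pdivlMr ?subr_gt0 //.
apply: le_trans (natmul_exp_le _ _) _; first by rewrite r0 ltW.
by rewrite ler_wpM2l // lerBlDr lerDl exprn_ge0.
Qed.

(** The remainder for [k + 1] is [z + h] times that for [k], plus [h^2 k z^(k-1)], and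
    [k^2 + k <= (k+1)^2]. The factor [r^2] on the left avoids the exponent [k - 2]. *)
Lemma exp_taylor_le (K : numFieldType) (z h r : K) k : `|z| <= r -> `|z + h| <= r ->
  `|(z + h) ^+ k - z ^+ k - h * (k%:R * z ^+ k.-1)| * r ^+ 2 <= `|h| ^+ 2 * (k%:R ^+ 2 * r ^+ k).
Proof.
move=> zr zhr; have r0 : 0 <= r by exact: le_trans zr.
elim: k => [|k IH]; first by rewrite mul0r mulr0 subrr subr0 normr0 mul0r expr0n mul0r mulr0.
have -> : (z + h) ^+ k.+1 - z ^+ k.+1 - h * (k.+1%:R * z ^+ k.+1.-1) =
   (z + h) * ((z + h) ^+ k - z ^+ k - h * (k%:R * z ^+ k.-1)) + h ^+ 2 * (k%:R * z ^+ k.-1).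
  by case: k {IH} => [|k]; rewrite -natr1 /= !exprS; ring.
apply: (@le_trans _ _ (r * (`|h| ^+ 2 * (k%:R ^+ 2 * r ^+ k)) + `|h| ^+ 2 * (k%:R * r ^+ k.+1))).
  rewrite (le_trans (ler_wpM2r _ (ler_normD _ _))) ?exprn_ge0 // mulrDl lerD //.
    rewrite normrM -mulrA ler_pM // ?mulr_ge0 ?exprn_ge0 //.
  rewrite normrM normrX -mulrA ler_wpM2l ?exprn_ge0 // normrM normr_nat -mulrA.
  case: k {IH} => [|k]; first by rewrite !mul0r.
  rewrite ler_wpM2l // normrX /= -[k.+2]addn2 exprD ler_wpM2r ?exprn_ge0 //.
  by rewrite lerXn2r ?nnegrE.
have -> : r * (`|h| ^+ 2 * (k%:R ^+ 2 * r ^+ k)) + `|h| ^+ 2 * (k%:R * r ^+ k.+1) =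
    `|h| ^+ 2 * ((k%:R ^+ 2 + k%:R) * r ^+ k.+1) by rewrite !exprS; ring.
rewrite ler_wpM2l ?exprn_ge0 // ler_wpM2r ?exprn_ge0 //.
by rewrite -natr1 sqrrD1 -addrA lerD2l mulr2n -addrA lerDl addr_ge0.
Qed.

Lemma geom_bounded_cvgn (R : realType) (a : nat -> CC R) (x : CC R) :
  0 <= x < 1 -> geom_bounded a x -> cvgn (series a).
Proof. by move=> x01 [M aM]; have [] := cvgn_series_geometric x01 aM. Qed.

Lemma limn_subr_mull (K : numFieldType) (u v w : nat -> K) (c : K) :
  cvgn u -> cvgn v -> cvgn w ->
  limn (fun n => u n - v n - c * w n) = limn u - limn v - c * limn w.
Proof.
move=> cu cv cw; apply: cvg_lim => //.
by apply: cvgB; [exact: cvgB|apply: cvgM => //; exact: cvg_cst].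
Qed.

Lemma limn_mull (K : numFieldType) (c : K) (u : nat -> K) :
  cvgn u -> limn (fun n => c * u n) = c * limn u.
Proof. by move=> cu; apply: cvg_lim => //; apply: cvgM => //; exact: cvg_cst. Qed.

Definition pser (K : numFieldType) (a : nat -> K) (z : K) : K :=
  limn (series (fun k => a k * z ^+ k)).

(* Stated for [z d/dz], which multiplies coefficients by [k] without shifting them. *)
Lemma is_derive_pser (R : realType) (a : nat -> CC R) (rho z : CC R) :
  geom_bounded a rho -> 0 < rho -> `|z| * rho < 1 ->
  exists2 d, is_derive z 1 (pser a) d & z * d = pser (fun k => k%:R * a k) z.
Proof.
move=> /geom_bounded_ge0[M0 M00 aM0] rho0 zrho1.
have zrho : `|z| < rho^-1 by rewrite -[rho^-1]mul1r ltr_pdivlMr.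
have [r zr rrho] : exists2 r, `|z| < r & r < rho^-1.
  by have [] := midf_lt zrho; exists ((`|z| + rho^-1) / 2%:R).
have r0 : 0 < r by exact: le_lt_trans zr.
pose b k := a k * r ^+ k.
have x1 : r * rho < 1 by rewrite -ltr_pdivlMr // mul1r.
have x0 : 0 <= r * rho by rewrite mulr_ge0 // ltW.
(* The Taylor remainder costs two factors [k]; each is paid for by a larger ratio, in the chain
   [r * rho < y < t < 1]. *)
have [y xy y1] : exists2 y, r * rho < y & y < 1.
  by have [] := midf_lt x1; exists ((r * rho + 1) / 2%:R).
have [t yt t1] : exists2 t, y < t & t < 1.
  by have [] := midf_lt y1; exists ((y + 1) / 2%:R).
have y0 : 0 <= y by rewrite (le_trans x0) // ltW.
have t0 : 0 <= t by rewrite (le_trans y0) // ltW.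
have b0 : geom_bounded b (r * rho).
  exists M0 => k; rewrite normrM normrX (gtr0_norm r0) exprMn [r ^+ k * rho ^+ k]mulrC mulrA.
  by rewrite ler_wpM2r ?exprn_ge0 // ltW.
have b1 : geom_bounded (fun k => k%:R * b k) y by apply: geom_boundedMn b0; rewrite x0.
have b2 : geom_bounded (fun k => k%:R * (k%:R * b k)) t by apply: geom_boundedMn b1; rewrite y0.
have cv w : `|w| <= r -> cvgn (series (fun k => a k * w ^+ k)).
  move=> wr; apply: (@geom_bounded_cvgn _ _ (r * rho)); first by rewrite x0.
  apply: geom_bounded_le b0 => k; rewrite !normrM ler_wpM2l // !normrX (gtr0_norm r0).
  by rewrite lerXn2r ?nnegrE // ltW.
have cv' : cvgn (series (fun k => a k * (k%:R * z ^+ k.-1))).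
  apply: (@geom_bounded_cvgn _ _ y); first by rewrite y0.
  apply: geom_bounded_le (geom_boundedZ r^-1 b1) => -[|k]; first by rewrite !mul0r mulr0 normr0.
  have -> : r^-1 * (k.+1%:R * b k.+1) = a k.+1 * (k.+1%:R * r ^+ k).
    by rewrite /b exprS; field; rewrite gt_eqF.
  rewrite !normrM ler_wpM2l // ler_wpM2l // !normrX (gtr0_norm r0) lerXn2r ?nnegrE // ltW //.
have [M M0' bM] := geom_bounded_ge0 b2.
pose C := M / (1 - t) / r ^+ 2.
have C0 : 0 <= C by rewrite !divr_ge0 ?exprn_ge0 ?subr_ge0 // ltW.
(* The termwise remainder estimates are summed as a geometric series of ratio [t], which gives the
   constant [C]. *)
have key h : `|z + h| <= r -> `|limn (series (fun k => a k * (z + h) ^+ k)) -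
    limn (series (fun k => a k * z ^+ k)) -
    h * limn (series (fun k => a k * (k%:R * z ^+ k.-1)))| <= C * `|h| ^+ 2.
  move=> zhr; pose D k := a k * ((z + h) ^+ k - z ^+ k - h * (k%:R * z ^+ k.-1)).
  have DM k : `|D k| <= `|h| ^+ 2 * M / r ^+ 2 * t ^+ k.
    rewrite mulrAC ler_pdivlMr ?exprn_gt0 // normrM -mulrA.
    have := ler_wpM2l (normr_ge0 (a k)) (exp_taylor_le k (ltW zr) zhr).
    move=> /le_trans; apply; rewrite mulrCA -[leRHS]mulrA ler_wpM2l ?exprn_ge0 //.
    apply: le_trans (bM k); rewrite !normrM !normr_nat normrX (gtr0_norm r0).
    by rewrite [leRHS](_ : _ = `|a k| * (k%:R ^+ 2 * r ^+ k)) //; ring.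
  have t01 : 0 <= t < 1 by rewrite t0.
  have [cD nD] := cvgn_series_geometric t01 DM.
  have DE : series D = (fun n => series (fun k => a k * (z + h) ^+ k) n -
      series (fun k => a k * z ^+ k) n - h * series (fun k => a k * (k%:R * z ^+ k.-1)) n).
    apply/funext => n; rewrite /series /= mulr_sumr -!sumrB; apply: eq_bigr => k _.
    by rewrite /D; ring.
  have <- : limn (series D) = limn (series (fun k => a k * (z + h) ^+ k)) -
    limn (series (fun k => a k * z ^+ k)) -
    h * limn (series (fun k => a k * (k%:R * z ^+ k.-1))).
    rewrite DE; exact: (limn_subr_mull h (cv _ zhr) (cv _ (ltW zr)) cv').
  apply: le_trans nD _; rewrite /C le_eqVlt; apply/orP; left; apply/eqP; field.
  by rewrite !gt_eqF ?subr_gt0.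
exists (limn (series (fun k => a k * (k%:R * z ^+ k.-1)))); last first.
  rewrite -[LHS](limn_mull z cv'); congr (limn _); apply/funext => n.
  rewrite /series /= mulr_sumr; apply: eq_bigr => k _.
  by case: k => [|k]; [rewrite !mul0r !mulr0|rewrite /= exprS; ring].
apply/is_derive1P => e e0; rewrite /pser.
pose d1 := r - `|z|; pose d2 := e / (C + 1).
have d10 : 0 < d1 by rewrite subr_gt0.
have C10 : 0 < C + 1 by rewrite ltr_wpDl.
have d20 : 0 < d2 by rewrite divr_gt0.
have d120 := addr_gt0 d10 d20.
(* This lies below both [d1], which keeps [z + h] in the disc of radius [r], and [d2], which makes
   [C |h| <= e]. *)
exists (d1 * d2 / (d1 + d2)); first exact: divr_gt0 (mulr_gt0 d10 d20) d120.
move=> h hd.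
have h1 : `|h| <= d1.
  apply: le_trans (ltW hd) _; rewrite ler_pdivrMr //.
  by rewrite ler_pM2l // lerDr ltW.
have h2 : `|h| <= d2.
  apply: le_trans (ltW hd) _; rewrite ler_pdivrMr // mulrC.
  by rewrite ler_pM2l // lerDl ltW.
apply: le_trans (key h _) _.
  by rewrite (le_trans (ler_normD _ _)) // -lerBrDl.
rewrite expr2 mulrA ler_wpM2r //; apply: le_trans (_ : (C + 1) * `|h| <= _).
  by rewrite ler_wpM2r // lerDl.
by rewrite mulrC -ler_pdivlMr.
Qed.

(** * The complex exponential *)

Lemma cexpD (R : realType) (z w : CC R) : cexp (z + w) = cexp z * cexp w.
Proof.
case: z w => a b [c d]; rewrite /cexp /= expRD cosD sinD.
apply/eqP; rewrite eq_complex /=; apply/andP; split; apply/eqP; ring.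
Qed.

Lemma cexp0 (R : realType) : cexp (0 : CC R) = 1.
Proof. by rewrite /cexp /= expR0 cos0 sin0 mulr1 mulr0. Qed.

Lemma cexpMn (R : realType) (z : CC R) n : cexp (z *+ n) = cexp z ^+ n.
Proof. by elim: n => [|n IH]; rewrite ?cexp0 // mulrS exprS cexpD IH. Qed.

Lemma norm_cexp (R : realType) (z : CC R) : `|cexp z| = rc (expR (complex.Re z)).
Proof.
by rewrite normc_def /= !exprMn -mulrDr cos2Dsin2 mulr1 sqrtr_sqr ger0_norm ?expR_ge0.
Qed.

Lemma cexp_neq0 (R : realType) (z : CC R) : cexp z != 0.
Proof. by rewrite -normr_gt0 norm_cexp -[0]/(rc 0) ltcR expR_gt0. Qed.

Lemma is_derive_cexp0 (R : realType) : is_derive (0 : CC R) 1 (@cexp R) 1.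
Proof.
apply/is_derive1P => e e0.
have [x x0 ex] := ge0_rc (ltW e0); move: e0; rewrite {e}ex -[0]/(rc 0) ltcR => {}x0.
(* The four error terms below are at most [e n], [2 e n], [4 e n] and [e n], with [n = |h|]; their
   total [8 e n] dictates the factor 8. *)
have [e [e0 e1 ex]] : exists e : R, [/\ 0 < e, e <= 1 & e * 8 <= x].
  exists (Num.min 1 (x / 8)); split; first by rewrite lt_min ltr01 divr_gt0.
    by rewrite ge_min lexx.
  by rewrite -ler_pdivlMr // ge_min lexx orbT.
have [d1 d10 H1] := (is_derive1P _ _ _).1 (is_derive_expR (0 : R)) e e0.
have [d2 d20 H2] := (is_derive1P _ _ _).1 (is_derive_cos (0 : R)) e e0.
have [d3 d30 H3] := (is_derive1P _ _ _).1 (is_derive_sin (0 : R)) e e0.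
(* Including [e] forces [|b| <= e], hence [|sin b| <= 2 e], which makes the product
   [(expR a - 1) * sin b] small enough. *)
pose d := Num.min (Num.min d1 d2) (Num.min d3 e).
have d0 : 0 < d by rewrite !lt_min d10 d20 d30 e0.
exists (rc d); first by rewrite ltcR.
move=> [a b] hd; rewrite add0r cexp0 mulr1.
have [n n0 nE] := ge0_rc (normr_ge0 ((a +i* b)%C : CC R)).
have an : `|a| <= n by have := Re_le_norm ((a +i* b)%C : CC R); rewrite nE lecR.
have bn : `|b| <= n by have := Im_le_norm ((a +i* b)%C : CC R); rewrite nE lecR.
move: hd; rewrite nE ltcR !lt_min => /andP[/andP[nd1 nd2] /andP[nd3 ne]].
have := H1 a (le_lt_trans an nd1); rewrite add0r expR0 mulr1 => {}H1.
have := H2 b (le_lt_trans bn nd2); rewrite add0r cos0 sin0 oppr0 mulr0 subr0 => {}H2.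
have := H3 b (le_lt_trans bn nd3); rewrite add0r sin0 cos0 mulr1 subr0 => {}H3.
rewrite -rcM; apply: le_trans (norm_le_ReIm _) _; rewrite lecR.
rewrite /cexp /=.
have -> : expR a * cos b - 1 - a = (expR a - 1 - a) * cos b + (1 + a) * (cos b - 1) by ring.
have -> : expR a * sin b - 0 - b = (expR a - 1) * sin b + (sin b - b) by ring.
have en : e * n <= n by rewrite -[leRHS]mul1r ler_wpM2r.
have n1 : n <= 1 by apply: le_trans (ltW ne) e1.
have A1 : `|(expR a - 1 - a) * cos b| <= e * n.
  rewrite normrM -[leRHS]mulr1 ler_pM //; last exact: cos_max.
  by rewrite (le_trans H1) // ler_wpM2l // ltW.
have A2 : `|(1 + a) * (cos b - 1)| <= 2 * (e * n).
  rewrite normrM ler_pM //; last by rewrite (le_trans H2) // ler_wpM2l // ltW.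
  rewrite (le_trans (ler_normD _ _)) // normr1 -[leRHS]/(1 + 1) lerD2l.
  exact: le_trans an n1.
have A3 : `|expR a - 1| <= 2 * n.
  rewrite -[expR a - 1](subrK a) (le_trans (ler_normD _ _)) // mulrDl mul1r lerD //.
  by rewrite (le_trans H1) // (le_trans _ en) // ler_wpM2l // ltW.
have A4 : `|sin b - b| <= e * n by rewrite (le_trans H3) // ler_wpM2l // ltW.
have A5 : `|sin b| <= 2 * e.
  rewrite -[sin b](subrK b) (le_trans (ler_normD _ _)) // mulrDl mul1r lerD //.
    by rewrite (le_trans A4) // -[leRHS]mulr1 ler_wpM2l // ltW.
  by rewrite (le_trans bn) // ltW.
have A6 : `|(expR a - 1) * sin b| <= 4 * (e * n).
  rewrite normrM (le_trans (ler_pM _ _ A3 A5)) //.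
  by rewrite [leLHS](_ : _ = 4 * (e * n)) //; ring.
apply: (@le_trans _ _ (8 * (e * n))); last by rewrite mulrA [8 * e]mulrC ler_wpM2r.
rewrite (le_trans (lerD (ler_normD _ _) (ler_normD _ _))) //; lra.
Qed.

Lemma is_derive_cexp (R : realType) (z : CC R) : is_derive z 1 (@cexp R) (cexp z).
Proof.
apply/is_derive1P => e e0.
have nz0 : 0 < `|cexp z| by rewrite normr_gt0 cexp_neq0.
have [d d0 H] := (is_derive1P _ _ _).1 (is_derive_cexp0 R) (e / `|cexp z|) (divr_gt0 e0 nz0).
exists d => // h /H; rewrite add0r cexp0 mulr1 cexpD => He.
have -> : cexp z * cexp h - cexp z - h * cexp z = cexp z * (cexp h - 1 - h) by ring.
by rewrite normrM mulrC -ler_pdivlMr // mulrAC.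
Qed.

Lemma is_derive_cexpZ (R : realType) (c t : CC R) :
  is_derive t 1 (fun t => cexp (c * t)) (c * cexp (c * t)).
Proof.
apply/is_derive1P => e e0.
have [->|c0] := eqVneq c 0.
  exists 1 => // h _; rewrite !mul0r subrr mulr0 subrr normr0 mulr_ge0 //; exact: ltW.
have nc0 : 0 < `|c| by rewrite normr_gt0.
have [d d0 H] := (is_derive1P _ _ _).1 (is_derive_cexp (c * t)) (e / `|c|) (divr_gt0 e0 nc0).
exists (d / `|c|); first exact: divr_gt0.
move=> h; rewrite ltr_pdivlMr // mulrC -normrM => /H; rewrite mulrDr normrM mulrA divfK ?gt_eqF //.
by rewrite mulrA [h * c]mulrC.
Qed.

(** * Lambert series and the Eisenstein series G2 *)

(** For [z = exp(c s)], [d/ds] is [c z d/dz], so the derivative is again a power series in [z] and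
    the step can be iterated. *)
Lemma is_derive_pser_cexp (R : realType) (a : nat -> CC R) (rho c t : CC R) :
  geom_bounded a rho -> 0 < rho -> `|cexp (c * t)| * rho < 1 ->
  is_derive t 1 (fun s => pser a (cexp (c * s)))
    (c * pser (fun k => k%:R * a k) (cexp (c * t))).
Proof.
move=> ga rho0 zrho; have [d dd <-] := is_derive_pser ga rho0 zrho.
apply: is_derive_eq (is_derive1_chain (is_derive_cexpZ c t) dd) _; ring.
Qed.

(** Since [rho < 1], the point [z = 1] is interior to the disc of convergence, and two termwise
    derivatives bring out [c^2 k^2]. *)
Lemma second_tau_derivative_pser (R : realType) (a : nat -> CC R) (rho t0 : CC R) :
  geom_bounded a rho -> 0 <= rho < 1 -> cexp (twopii R * t0) = 1 ->
  second_tau_derivative a t0 (twopii R ^+ 2 * limn (series (fun k => k%:R ^+ 2 * a k))).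
Proof.
move=> ga /andP[rho0 rho1] ct0; set c := twopii R; set d := c ^+ 2 * _.
have [x rx x1] : exists2 x, rho < x & x < 1.
  by have [] := midf_lt rho1; exists ((rho + 1) / 2%:R).
have x0 : 0 < x by exact: le_lt_trans rx.
have ga0 : geom_bounded a x.
  have [M M0 aM] := geom_bounded_ge0 ga; exists M => k.
  by rewrite (le_trans (aM k)) // ler_wpM2l // lerXn2r ?nnegrE // ltW.
have ga1 : geom_bounded (fun k => k%:R * a k) x by apply: geom_boundedMn ga; rewrite rho0.
have nearx : \forall t \near t0, `|cexp (c * t)| * x < 1.
  have cE : (fun t => cexp (c * t)) @ t0 --> cexp (c * t0).
    exact: is_derive1_continuous (is_derive_cexpZ c t0).
  have : `|cexp (c * t0)| < x^-1 by rewrite ct0 normr1 invf_gt1.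
  move/(cvgr_norm_lt _ cE); apply: filterS => t.
  by rewrite -[x^-1]mul1r ltr_pdivlMr.
(* The first derivative is needed on a whole neighbourhood, so that [derive1] can be replaced by an
   explicit series before differentiating again. *)
have D1 : \forall t \near t0, is_derive (t : CC R) 1 (fun s => pser a (cexp (c * s)))
    (c * pser (fun k => k%:R * a k) (cexp (c * t))).
  by apply: filterS nearx => t; exact: is_derive_pser_cexp.
have E1 : \forall t \near t0, c * pser (fun k => k%:R * a k) (cexp (c * t)) =
    derive1 (fun s => pser a (cexp (c * s))) t.
  by apply: filterS D1 => t [_ <-]; rewrite derive1E.
have D2 : is_derive t0 1 (derive1 (fun s => pser a (cexp (c * s)))) d.
  apply: near_eq_is_derive E1 _.
  apply: is_derive_eq (is_deriveZ c (is_derive_pser_cexp ga1 x0 (nbhs_singleton nearx))) _.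
  have ak : (fun k => k%:R * (k%:R * a k) * 1 ^+ k) = (fun k => k%:R ^+ 2 * a k).
    by apply/funext => k; rewrite expr1n mulr1 mulrA.
  by rewrite ct0 /pser ak -[LHS]/(c * (c * _)) mulrA.
split.
- apply: filterS nearx => t tx; apply: (@geom_bounded_cvgn _ _ (`|cexp (c * t)| * x)).
    by rewrite tx mulr_ge0 // ltW.
  have [M aM] := ga0; exists M => k.
  by rewrite normrM normrX exprMn [_ ^+ k * _]mulrC mulrA ler_wpM2r ?exprn_ge0.
- by apply: filterS D1 => t [].
- by have [] := D2.
- by have [_ <-] := D2; rewrite -derive1E.
Qed.

Lemma geom_bounded_lambert (K : numFieldType) (y q : K) : `|q| < 1 ->
  geom_bounded (fun k => y ^+ k / (1 - q ^+ k)) `|y|.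
Proof.
move=> q1; exists (1 - `|q|)^-1 => k.
have q10 : 0 < 1 - `|q| by rewrite subr_gt0.
rewrite normrM normrX mulrC ler_wpM2r ?exprn_ge0 //.
(* At [k = 0] the denominator is 0 and the quotient is 0 by convention. For [k >= 1],
   [|1 - q^k| >= 1 - |q|]. *)
have [->|k0] := posnP k; first by rewrite expr0 subrr invr0 normr0 invr_ge0 ltW.
have qk : `|q| ^+ k <= `|q| by case: k k0 => // k _; rewrite exprS ler_piMr // exprn_ile1 // ltW.
rewrite normfV lef_pV2 ?posrE //; last first.
  apply: lt_le_trans (lerB_dist _ _).
  by rewrite normr1 normrX subr_gt0 (le_lt_trans qk).
apply: le_trans (lerB_dist _ _); by rewrite normr1 normrX lerB.
Qed.

Lemma cvgn_lambert (R : realType) (x q : CC R) : `|x| < 1 -> `|q| < 1 ->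
  cvgn (series (fun k => k%:R * (x ^+ k / (1 - q ^+ k)))).
Proof.
move=> x1 q1; have [z xz z1] : exists2 z, `|x| < z & z < 1.
  by have [] := midf_lt x1; exists ((`|x| + 1) / 2%:R).
apply: (@geom_bounded_cvgn _ _ z); first by rewrite z1 (le_trans _ (ltW xz)).
by apply: geom_boundedMn (geom_bounded_lambert x q1); rewrite normr_ge0.
Qed.

Lemma limn_series_shift (K : numFieldType) (u : nat -> K) :
  cvgn (series u) -> limn (series (fun n => u n.+1)) = limn (series u) - u 0%N.
Proof.
move=> cu; apply: cvg_lim => //.
have -> : series (fun n => u n.+1) = (fun n => series u n.+1 - u 0%N).
  by apply/funext => n; rewrite /series /= big_nat_recl // addrC addKr.
by apply: cvgB; [rewrite cvg_shiftS|exact: cvg_cst].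
Qed.

Lemma limn_seriesZ (K : numFieldType) (c : K) (u : nat -> K) :
  cvgn (series u) -> limn (series (fun n => c * u n)) = c * limn (series u).
Proof.
move=> cu; rewrite -limn_mull //; congr (limn _); apply/funext => n.
by rewrite /series /= mulr_sumr.
Qed.

Lemma limn_geometric_series (R : realType) (c x : CC R) : `|x| < 1 ->
  limn (series (fun r => c * x ^+ r.+1)) = c * x / (1 - x).
Proof.
move=> x1; have x01 : 0 <= `|x| < 1 by rewrite normr_ge0.
have nx1 : 1 - x != 0 by apply: contraTneq x1 => /subr0_eq <-; rewrite normr1 ltxx.
have gx : geom_bounded (fun r => c * x ^+ r) `|x|.
  by exists `|c| => k; rewrite normrM normrX.
have cs := geom_bounded_cvgn x01 gx.
(* Let [L] be the sum of [c x^r]. Dropping its first term gives [L - c], factoring out [x] gives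
   [x L]; the equality determines the sum. *)
have := limn_series_shift cs; rewrite expr0 mulr1.
have -> : (fun r => c * x ^+ r.+1) = (fun r => x * (c * x ^+ r)).
  by apply/funext => r; rewrite exprS mulrCA.
rewrite (limn_seriesZ x cs); move: (limn _) => L E.
apply: (mulIf nx1); rewrite divfK //.
by have -> : x * L * (1 - x) = x * (L - x * L); [ring|rewrite E; ring].
Qed.

(** The inner sums over [r] are geometric. The Lambert series may start at [k = 0] because its
    factor [k] kills that term. *)
Lemma G2_lambert (R : realType) (tau : CC R) (x := cexp (twopii R * tau)) : `|x| < 1 ->
  G2 tau = twopii R ^+ 2 * (- 24%:R^-1 + limn (series (fun k => k%:R * (x ^+ k / (1 - x ^+ k))))).
Proof.
move=> x1; rewrite /G2 -/x; congr (_ * (_ + _)).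
have := limn_series_shift (cvgn_lambert x1 x1); rewrite mul0r subr0 => <-.
congr (limn _); congr series; apply/funext => m.
rewrite mulrA -limn_geometric_series; last by rewrite normrX exprn_ilt1.
by congr (limn _); congr series; apply/funext => r; rewrite -exprM.
Qed.

Lemma G2_half_sub (R : realType) (tau : CC R)
    (q := cexp (twopii R * tau)) (y := cexp (twopii R / 2%:R * tau)) :
  y ^+ 2 = q -> `|y| < 1 ->
  G2 (tau / 2%:R) - G2 tau =
    twopii R ^+ 2 * limn (series (fun k => k%:R * (y ^+ k / (1 - q ^+ k)))).
Proof.
move=> yq y1.
have yE : cexp (twopii R * (tau / 2%:R)) = y by rewrite /y; congr cexp; ring.
have q1 : `|q| < 1 by rewrite -yq normrX exprn_ilt1.
rewrite !G2_lambert ?yE //.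
rewrite -mulrBr opprD addrACA subrr add0r -limB; [|exact: cvgn_lambert..].
congr (_ * _); congr (limn _); apply/funext => n.
rewrite -[LHS]/(_ - _) /series /= -sumrB; apply: eq_bigr => k _; rewrite -mulrBr; congr (_ * _).
have [->|k0] := posnP k; first by rewrite !expr0 !subrr invr0 mulr0.
have yk1 : `|y ^+ k| < 1 by rewrite normrX exprn_ilt1 -?lt0n.
have nz w : `|w| < 1 -> 1 - w != 0.
  by move=> w1; apply: contraTneq w1 => /subr0_eq <-; rewrite normr1 ltxx.
have y2 : q ^+ k = (y ^+ k) ^+ 2 by rewrite -yq -!exprM mulnC.
have nz2 : 1 - (y ^+ k) ^+ 2 != 0 by rewrite nz // normrX exprn_ilt1.
by rewrite y2; field; rewrite nz2 nz.
Qed.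

(** * The second derivative of the logarithm of the quantum dilogarithm *)

Lemma formal_log_qdilog (R : realType) (tau : CC R)
    (q := cexp (twopii R * tau)) (y := cexp (twopii R / 2%:R * tau)) :
  y ^+ 2 = q -> (forall m, q ^+ m.+1 != 1) ->
  formal_log (qdilog tau) =1 (fun k => k%:R^-1 * (y ^+ k / (1 - q ^+ k))).
Proof.
move=> yq q1 [|n].
  (* In degree 0 the left side is an empty sum, and the right side is 0 because [0^-1 = 0]. *)
  by rewrite /formal_log big_geq // coef0 invr0 mul0r.
have qE := qdilog_qexp yq (cexp_neq0 _) q1.
rewrite (@formal_log_rec _ _ (fun k => k%:R^-1 * (y ^+ k / (1 - q ^+ k)))) //.
  by rewrite qE /qexp big_ord0 divr1.
move=> m; rewrite qE qexp_log_deriv //; apply: eq_bigr => k _; rewrite qE; congr (_ * _).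
by rewrite mulrA mulfV ?mul1r // pnatr_eq0.
Qed.

Lemma formal_log_qdilog_derivative (R : realType) (tau tau' : CC R) :
  0 < complex.Im tau -> cexp (twopii R * tau') = 1 ->
  second_tau_derivative (formal_log (qdilog tau)) tau' (G2 (tau / 2%:R) - G2 tau).
Proof.
move=> tau0 t1; pose q := cexp (twopii R * tau); pose y := cexp (twopii R / 2%:R * tau).
have yq : y ^+ 2 = q by rewrite -cexpMn; congr cexp; field.
(* [|q| = exp(- 2 pi Im tau)]; consequently no positive power of [q] is 1. *)
have q1 : `|q| < 1.
  rewrite norm_cexp -[1]/(rc 1) ltcR -expR0 ltr_expR.
  case: tau {q y yq} tau0 => a b /= b0.
  rewrite !(mulr0, mul0r, mulr1, addr0, add0r, sub0r, oppr0) oppr_lt0.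
  by rewrite mulr_gt0 // mulr_gt0 // pi_gt0.
have y1 : `|y| < 1 by rewrite -(@expr_lt1 _ 2) // -normrX yq.
have qn1 m : q ^+ m.+1 != 1.
  by apply: contraTneq q1 => /(congr1 Num.norm); rewrite normrX normr1 => /eqP;
    rewrite pexprn_eq1 //= => /eqP ->; rewrite ltxx.
rewrite (G2_half_sub yq y1) (funext (formal_log_qdilog yq qn1)).
have ga : geom_bounded (fun k => k%:R^-1 * (y ^+ k / (1 - q ^+ k))) `|y|.
  apply: geom_bounded_le (geom_bounded_lambert y q1) => -[|k].
    by rewrite invr0 mul0r normr0.
  by rewrite normrM ler_piMl // normfV normr_nat invf_le1 ?ler1n.
have -> : (fun k => k%:R * (y ^+ k / (1 - q ^+ k))) =
    (fun k => k%:R ^+ 2 * (k%:R^-1 * (y ^+ k / (1 - q ^+ k)))).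
  apply/funext => -[|k]; first by rewrite expr0n !mul0r.
  by rewrite [RHS]mulrA expr2 mulfK // pnatr_eq0.
by apply: second_tau_derivative_pser ga _ t1; rewrite normr_ge0.
Qed.

Unset Implicit Arguments.

Theorem theorem1p6 (R : realType) :
  exists eps : R, 0 < eps /\
  forall
    (* models of D^b(Coh X), D^b_G(Coh X) and D^b(mod A_3^(5)) *)
    (D : dercat (CohX R)) (DG : dercat (CohGX R)) (DM : dercat (modA (CC R)))
    (* the structure sheaf O_X *)
    (O : CohX R) (OX : D)
    (hO : is_structure_sheaf (O : coh R)) (hOX : in_degree0 O OX)
    (* the autoequivalence tau_0 = O(1) (x) T_(O_X)(-) and a quasi-inverse of it *)
    (tw : lfunctor (CohX R) (CohX R)) (L T : trifunctor D D)
    (htw : is_O1_twist tw) (hL : is_derived_of tw L)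
    (hT : is_spherical_twist OX T)
    (htau0 : is_equivalence (lfcomp L T))
    (tau0inv : lfunctor D D) (htau0inv : quasi_inverse (lfcomp L T) tau0inv)
    (* forgetting the equivariance *)
    (For : trifunctor DG D) (hFor : is_derived_of (forget R) For)
    (* the equivalence D^b(mod A_3^(5)) = D^b_G(Coh X) *)
    (Phi : trifunctor DM DG) (hPhi : is_equivalence Phi)
    (hsimple : forall (s : vertex) (Y : DM), is_simple s Y ->
       isomorphic (For (Phi Y)) (iter (vsum s) tau0inv OX))
    (* the Chern character *)
    (ch : D -> {poly rat}) (hch : is_chern_character OX L ch)
    (* the stability condition *)
    (sg : stability DG)
    (hheart : forall E : DG, heart (st_t sg) E <->
       exists (M : modA (CC R)) (Y : DM), in_degree0 M Y /\ isomorphic E (Phi Y))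
    (hZ : quintic_central_charge eps For Phi ch sg)
    (hstable : forall E : DG, stable sg E <->
       exists (s : vertex) (Y : DM), is_simple s Y /\ isomorphic E (Phi Y))
    (* a stable object of D^b(Coh X) *)
    (S : D) (hS : exists E : DG, stable sg E /\ isomorphic S (For E)),
  exists sphS : spherical S,
  forall tau : CC R, 0 < complex.Im tau ->
  forall tau' : CC R, cexp (twopii R * tau') = 1 ->
    second_tau_derivative (formal_log (mdt_series sphS tau)) tau'
      (G2 (tau / 2%:R) - G2 tau).
Proof.
exists 1; split=> // D DG DM O OX _ _ tw L T _ _ [sOX _ _] tau0eq tau0inv hinv For _ Phi _.
move=> hsimple ch _ sg _ _ hstable S [E [/hstable[s [Y [Ys EY]]] SE]].
(* The shift is moved through [T], then through [L]. *)
have tau0sh X : isomorphic (lfcomp L T (dsh D X)) (dsh D (lfcomp L T X)).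
  apply: isomorphic_trans (isomorphic_fob L (isomorphic_natiso (tf_sh T) X)) _.
  exact: isomorphic_natiso (tf_sh L) (T X).
have siter n : spherical (iter n tau0inv OX).
  by elim: n => //= n; exact: spherical_quasi_inverse tau0eq tau0sh hinv _.
(* The chain is [S = For E = For (Phi Y) = tau_0^(- vsum s) O_X] up to isomorphism. *)
have sphS : spherical S.
  apply: spherical_isomorphic (siter (vsum s)); apply: isomorphic_trans SE _.
  exact: isomorphic_trans (isomorphic_fob For EY) (hsimple s Y Ys).
by exists sphS => tau tau_gt0 tau' tau'1; exact: formal_log_qdilog_derivative.
Qed.
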